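(* Let $(X,\mathsf d,\mathfrak m,\mathcal E)$ be an MMD space, let $\sigma\in\mathbb R$, $N>0$, $0<q\le N$, and let $X\in\mathrm{HSCod}(\sigma,N,q)$. Suppose that for some $a_i\downarrow0$, some $c_i>0$ and some $x_i\in X$, the rescaled pointed spaces $(X,a_i\mathsf d,c_i\mathfrak m,x_i)$ converge in entropy--heat sense (with normalization dimension $N$) to a pointed MMD space $(X_\infty,\mathsf d_\infty,\mathfrak m_\infty,x_\infty)$. Then $X_\infty$ satisfies the exact forward codimension-$q$ comparison (with normalization dimension $N$). If, moreover, a further pointed rescaling of $X_\infty$ (a sequence $(X_\infty,b_j\mathsf d_\infty,c_j'\mathfrak m_\infty,y_j)$ with $b_j,c_j'>0$, $y_j\in X_\infty$) converges in entropy--heat sense to $(\mathbb R^m,\mathsf d_{\mathrm E},c\mathcal L^m,0)$ for some $c>0$, where $\mathsf d_{\mathrm E}$ is the Euclidean distance and $\mathcal L^m$ is Lebesgue measure, then $m\le N-q$.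
   Context: MMD space (metric measure Dirichlet space): a proper complete separable metric space $(X,\mathsf d)$, a full-support Radon measure $\mathfrak m$, and a strongly local regular symmetric Dirichlet form $(\mathcal E,\mathcal D(\mathcal E))$ on $L^2(X,\mathfrak m)$ whose energy measures are absolutely continuous with respect to $\mathfrak m$, with carré du champ density $\Gamma$, and such that the intrinsic distance $\sup\{f(x)-f(y): f\in\mathcal D_{\rm loc}(\mathcal E)\cap C(X),\ \Gamma(f)\le1\ \mathfrak m\text{-a.e.}\}$ equals $\mathsf d(x,y)$. Standing assumptions on every MMD space: the heat semigroup $(P_t)_{t>0}$ is conservative and has a jointly continuous, strictly positive, symmetric heat kernel $p:(0,\infty)\times X\times X\to(0,\infty)$ with $P_tf(x)=\int_Xp_t(x,y)f(y)\,d\mathfrak m(y)$ for bounded Borel $f$, $\int_Xp_t(x,y)\,d\mathfrak m(y)=1$, and $p_{t+s}(x,y)=\int_Xp_t(x,z)p_s(z,y)\,d\mathfrak m(z)$; for the normalization dimensions $N>0$ in use, the pointed Nash entropies $$\mathcal N_x^{(N)}(t):=-\int_Xp_t(x,y)\log p_t(x,y)\,d\mathfrak m(y)-\frac N2\log(4\pi t)-\frac N2$$ are finite for all $x\in X$, $t>0$, and $\mathcal N^{(N)}_\bullet(t)$ is integrable against $p_s(x,\cdot)\mathfrak m$ for all $x$ and $s,t>0$. Put $\mathbf N_x^{(N)}(t,s):=P_s(\mathcal N^{(N)}_\bullet(t))(x)$. On $\mathbb R^m$ the Dirichlet form is the standard one, $\int|\nabla f|^2\,c\,d\mathcal L^m$.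 Rescaling: for $a,c>0$, $(X,a\mathsf d,c\mathfrak m)$ carries the Dirichlet form $ca^{-2}\mathcal E$ (so its heat semigroup is $P_{a^{-2}t}$). Inverse-time geodesics: curves $\gamma_\theta=(t_\theta,s_\theta)\in(0,\infty)^2$, $\theta\in[0,1]$, with $t_\theta+s_\theta$ constant and $t_\theta^{-1}=(1-\theta)t_0^{-1}+\theta t_1^{-1}$. A function is concave along $\gamma$ if its composition with $\theta\mapsto\gamma_\theta$ is concave on $[0,1]$. Put $\mathscr T^+:=\{(t,s)\in(0,\infty)^2:t\le s\}$, $\mathscr T_S^+:=\{(t,s):S\le t\le s\}$. $X$ has heat scalar curvature at least $\sigma$ in dimension $N$ if there is $\tau>0$ such that for every $x\in X$, $\mathbf N_x^{(N)}(t,s)+\frac\sigma2t$ is concave along every inverse-time geodesic contained in $(0,\tau)^2$. $X\in\mathrm{HSCod}(\sigma,N,q)$, $q\in[0,N]$, if in addition, when $q>0$, there is $S>0$ such that for every $x\in X$, $\mathbf N_x^{(N)}(t,s)+\frac q2\log t$ is concave along every inverse-time geodesic contained in $\mathscr T_S^+$. $X$ satisfies the exact forward codimension-$q$ comparison (normalization $N$) if for every $x\in X$, $\mathbf N_x^{(N)}(t,s)+\frac q2\log t$ is concave along every inverse-time geodesic contained in $\mathscr T^+$. Entropy--heat convergence (normalization $N$): pointed MMD spaces $(X_i,\mathsf d_i,\mathfrak m_i,\mathcal E_i,x_i)$ converge in entropy--heat sense to $(X,\mathsf d,\mathfrak m,\mathcal E,x)$ if the underlying pointed measured spaces converge in a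 fixed geometric construction (a realization of pointed measured Gromov--Hausdorff convergence, e.g. by isometric embeddings into a common metric space, which gives meaning to $z_i\to z$ for $z_i\in X_i$, $z\in X$) and, for every convergent sequence of poles $z_i\to z$, $\mathcal N_{z_i}^{(N),i}(t)\to\mathcal N_z^{(N)}(t)$ locally uniformly for $t>0$ and $\mathbf N_{z_i}^{(N),i}(t,s)\to\mathbf N_z^{(N)}(t,s)$ locally uniformly for $(t,s)\in(0,\infty)^2$. *)

(* Defs.v *)
From HB Require Import structures.
From mathcomp Require Import all_boot all_order all_algebra.
From mathcomp Require Import all_classical all_reals all_analysis.
From mathcomp Require Import lra.
Set Implicit Arguments.
Unset Strict Implicit.
Unset Printing Implicit Defensive.
Import Order.TTheory GRing.Theory Num.Theory.
Import numFieldNormedType.Exports.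
Local Open Scope classical_set_scope.
Local Open Scope ring_scope.


Notation borel T := (g_sigma_algebraType (@open T)).

(* The distance is a field, and not a [metricType] structure on the carrier, so
   that rescaling it does not change the type of the space. *)
Record mmd_data (R : realType) := MMDData {
  carrier :> ptopologicalType ;
  dist : carrier -> carrier -> R ;
  refm : {measure set (borel carrier) -> \bar R} ;
  dom : set (carrier -> R) ;
  form : (carrier -> R) -> (carrier -> R) -> R }.
Arguments dist {R} _ _ _.
Arguments refm {R} _.
Arguments dom {R} _ _.
Arguments form {R} _ _ _.

Section mmd.
Context {R : realType} (X : mmd_data R).
Implicit Types (f g h : X -> R) (x y : X).
Local Notation mu := (refm X).

Definition mmd_integral f : R := \int[mu]_(x in [set: borel X]) f x.

Definition L2 : set (X -> R) :=
  [set f | (f : borel X -> R) \in Lfun mu 2%:E].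

Definition L2norm f : \bar R := ('N[mu]_(2%:E)[EFin \o (f : borel X -> R)])%E.

Definition ae_on (A : set X) (P : X -> Prop) : Prop :=
  {ae mu, forall x : borel X, A x -> P x}.

Record metric_ax : Prop := {
  dist_eq0 : forall x y, dist X x y = 0 <-> x = y ;
  dist_sym : forall x y, dist X x y = dist X y x ;
  dist_triangle : forall x y z, dist X x z <= dist X x y + dist X y z ;
  dist_nbhs : forall x (A : set X), nbhs x A <->
    exists2 e : R, 0 < e & [set y | dist X x y < e] `<=` A }.

Definition complete_dist : Prop := forall u : nat -> X,
  (forall e : R, 0 < e -> exists n0 : nat, forall n k : nat,
     (n0 <= n)%N -> (n0 <= k)%N -> dist X (u n) (u k) < e) ->
  exists x : X, u n @[n --> \oo] --> x.

Definition separable : Prop := exists S : set X, countable S /\ dense S.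

Definition proper_dist : Prop :=
  forall (x : X) (r : R), compact [set y | dist X x y <= r].

Record radon : Prop := {
  radon_compact : forall K : set X, compact K -> (mu K < +oo)%E ;
  radon_regular : forall A : set (borel X), measurable A ->
    mu A = ereal_sup [set mu K | K in [set K : set X | compact K /\ K `<=` A]] }.

Definition full_support : Prop :=
  forall U : set X, open U -> U !=set0 -> (0 < mu U)%E.

(* Functions stand for their classes modulo a.e. equality, hence [dom_ae] and
   [form_ae]. *)
Record symmetric_form : Prop := {
  dom_L2 : dom X `<=` L2 ;
  dom_ae : forall f g, dom X f -> L2 g -> ae_on setT (fun x => f x = g x) ->
    dom X g ;
  form_ae : forall f g h, dom X f -> dom X g -> dom X h ->
    ae_on setT (fun x => f x = g x) -> form X f h = form X g h ;
  dom_linear : forall (a : R) f g, dom X f -> dom X g ->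
    dom X (fun x => a * f x + g x) ;
  form_linear : forall (a : R) f g h, dom X f -> dom X g -> dom X h ->
    form X (fun x => a * f x + g x) h = a * form X f h + form X g h ;
  form_sym : forall f g, dom X f -> dom X g -> form X f g = form X g f ;
  form_ge0 : forall f, dom X f -> 0 <= form X f f ;
  dom_dense : forall f (e : R), L2 f -> 0 < e ->
    exists2 g, dom X g & (L2norm (f \- g)%R < e%:E)%E }.

Definition form1 f : R := form X f f + mmd_integral (fun x => f x ^+ 2).

Definition closed_form : Prop := forall u : nat -> X -> R,
  (forall n, dom X (u n)) ->
  (forall e : R, 0 < e -> exists n0 : nat, forall n k : nat,
     (n0 <= n)%N -> (n0 <= k)%N -> form1 (u n \- u k) < e) ->
  exists2 f, dom X f & form1 (u n \- f) @[n --> \oo] --> (0 : R).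

Definition markovian : Prop := forall f, dom X f ->
  let g := fun x => Num.min (Num.max (f x) 0) 1 in
  dom X g /\ form X g g <= form X f f.

Definition vanishes_outside (K : set X) f : Prop :=
  ae_on (~` K) (fun x => f x = 0).

Definition Cc : set (X -> R) := [set f | continuous f /\
  exists K : set X, compact K /\ forall x, ~ K x -> f x = 0].

Definition regular_form : Prop :=
  (forall f (e : R), dom X f -> 0 < e ->
     exists g, [/\ dom X g, Cc g & form1 (f \- g) < e]) /\
  (forall f (e : R), Cc f -> 0 < e ->
     exists g, [/\ dom X g, Cc g & forall x, `|f x - g x| < e]).

(* [K] and [L] contain the supports of the measures f mu and g mu. *)
Definition strongly_local : Prop := forall f g (K L U : set X) (a : R),
  dom X f -> dom X g -> compact K -> compact L ->
  vanishes_outside K f -> vanishes_outside L g ->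
  open U -> K `<=` U -> ae_on U (fun x => g x = a) -> form X f g = 0.

Definition trunc (n : nat) f : X -> R :=
  fun x => Num.min (Num.max (f x) (- n%:R)) n%:R.

(* [G] is the density of the energy measure of [f]: for bounded [f] the
   sequence is eventually E(f phi, f) - E(f^2, phi) / 2, and in general the
   energy measure of [f] is the limit of those of its truncations. The
   normalization is E(f, f) = \int Gamma(f), so that Gamma(f) = |grad f|^2 for
   the form \int |grad f|^2. *)
Definition is_carre_du_champ f (G : X -> R) : Prop :=
  [/\ (forall x, 0 <= G x),
      mu.-integrable setT (fun x : borel X => (G x)%:E) &
      forall phi, dom X phi -> Cc phi ->
        form X (trunc n f \* phi) (trunc n f)
          - form X (fun x => trunc n f x ^+ 2) phi / 2
        @[n --> \oo] --> mmd_integral (fun x => phi x * G x)].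

Definition has_carre_du_champ : Prop :=
  forall f, dom X f -> exists G, is_carre_du_champ f G.

Definition dom_loc : set (X -> R) := [set f |
  forall U : set X, open U -> compact (closure U) ->
    exists2 g, dom X g & ae_on U (fun x => f x = g x)].

Definition is_local_carre_du_champ f (G : X -> R) : Prop :=
  forall U : set X, open U -> compact (closure U) ->
    exists g G', [/\ dom X g, is_carre_du_champ g G',
      ae_on U (fun x => f x = g x) & ae_on U (fun x => G x = G' x)].

Definition intrinsic_dist x y : \bar R :=
  ereal_sup [set (f x - f y)%:E | f in [set f |
    [/\ dom_loc f, continuous f &
        exists2 G, is_local_carre_du_champ f G &
          ae_on setT (fun z => G z <= 1)]]].

(* [L f = Lf] for the generator [L] of the form: E(f, g) = - \int g L f. *)
Definition is_generator f (Lf : X -> R) : Prop :=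
  [/\ dom X f, L2 Lf &
      forall g, dom X g -> form X f g = - mmd_integral (fun x => g x * Lf x)].

(* [u t = P_t f]: the solution in L^2 of the Cauchy problem u' = L u,
   u(0) = f. *)
Definition is_heat_flow f (u : R -> X -> R) : Prop :=
  (L2norm (u t \- f) @[t --> (0 : R)^'+] --> 0%E) /\
  (forall t : R, 0 < t -> exists2 v : X -> R, is_generator (u t) v &
     L2norm (fun x => h^-1 * (u (t + h) x - u t x) - v x)
       @[h --> (0 : R)^'] --> 0%E).

Definition kernel_op (p : R -> X -> X -> R) (t : R) f : X -> R :=
  fun x => mmd_integral (fun y => p t x y * f y).

Record is_heat_kernel (p : R -> X -> X -> R) : Prop := {
  heat_kernel_continuous : forall (t : R) x y, 0 < t ->
    {for (t, x, y), continuous (fun u : R * X * X => p u.1.1 u.1.2 u.2)} ;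
  heat_kernel_gt0 : forall (t : R) x y, 0 < t -> 0 < p t x y ;
  heat_kernel_sym : forall (t : R) x y, 0 < t -> p t x y = p t y x ;
  heat_kernel_flow : forall f, L2 f -> (exists M : R, forall x, `|f x| <= M) ->
    is_heat_flow f (fun t => kernel_op p t f) ;
  heat_kernel_mass : forall (t : R) x, 0 < t ->
    (\int[mu]_(y in [set: borel X]) (p t x y)%:E = 1)%E ;
  heat_kernel_semigroup : forall (t s : R) x y, 0 < t -> 0 < s ->
    ((p (t + s) x y)%:E =
     \int[mu]_(z in [set: borel X]) (p t x z * p s z y)%:E)%E }.

(* Uniquely determined, at positive times, by the form. *)
Definition heat_kernel : R -> X -> X -> R :=
  xget (fun _ _ _ => 0) is_heat_kernel.

Definition nash (N t : R) x : R :=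
  - mmd_integral (fun y => heat_kernel t x y * ln (heat_kernel t x y))
  - N / 2 * ln (4 * pi * t) - N / 2.

Definition heat_nash (N : R) x (t s : R) : R :=
  kernel_op heat_kernel s (nash N t) x.

Record is_mmd (N : R) : Prop := {
  mmd_metric : metric_ax ;
  mmd_proper : proper_dist ;
  mmd_complete : complete_dist ;
  mmd_separable : separable ;
  mmd_radon : radon ;
  mmd_full_support : full_support ;
  mmd_form : symmetric_form ;
  mmd_closed : closed_form ;
  mmd_markovian : markovian ;
  mmd_regular : regular_form ;
  mmd_strongly_local : strongly_local ;
  mmd_carre_du_champ : has_carre_du_champ ;
  mmd_intrinsic : forall x y, intrinsic_dist x y = (dist X x y)%:E ;
  mmd_heat_kernel : exists p, is_heat_kernel p ;
  mmd_nash_finite : forall (t : R) x, 0 < t ->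
    mu.-integrable setT (fun y : borel X =>
      (heat_kernel t x y * ln (heat_kernel t x y))%:E) ;
  mmd_nash_integrable : forall (t s : R) x, 0 < t -> 0 < s ->
    mu.-integrable setT (fun y : borel X =>
      (heat_kernel s x y * nash N t y)%:E) }.

End mmd.

Section rescaling.
Context {R : realType}.

Definition rescale (a c : {posnum R}) (X : mmd_data R) : mmd_data R :=
  {| carrier := X ;
     dist := fun x y => a%:num * dist X x y ;
     refm := mscale c%:num%:nng (refm X) ;
     dom := dom X ;
     form := fun f g => c%:num / a%:num ^+ 2 * form X f g |}.

End rescaling.

Section comparison.
Context {R : realType}.
Implicit Types (gamma : R -> R * R) (A : set (R * R)) (F : R -> R -> R).

Definition inverse_time_geodesic gamma : Prop :=
  forall theta : R, theta \in `[0, 1] ->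
    [/\ 0 < (gamma theta).1, 0 < (gamma theta).2,
        (gamma theta).1 + (gamma theta).2 = (gamma 0).1 + (gamma 0).2 &
        (gamma theta).1^-1 =
          (1 - theta) * (gamma 0).1^-1 + theta * (gamma 1).1^-1].

Definition concave_along F gamma : Prop :=
  convex_function (E := R^o) `[0, 1]%classic
    (fun theta => - F (gamma theta).1 (gamma theta).2).

Definition concave_in A F : Prop := forall gamma,
  inverse_time_geodesic gamma ->
  (forall theta : R, theta \in `[0, 1] -> A (gamma theta)) ->
  concave_along F gamma.

Definition forward_region : set (R * R) :=
  [set u | [/\ 0 < u.1, 0 < u.2 & u.1 <= u.2]].

Definition forward_region_from (S : R) : set (R * R) :=
  [set u | S <= u.1 /\ u.1 <= u.2].

Definition heat_scalar_ge (sigma N : R) (X : mmd_data R) : Prop :=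
  exists2 tau : R, 0 < tau & forall x : X,
    concave_in [set u | [/\ 0 < u.1, u.1 < tau, 0 < u.2 & u.2 < tau]]
      (fun t s => heat_nash N x t s + sigma / 2 * t).

Definition HSCod (sigma N q : R) (X : mmd_data R) : Prop :=
  [/\ 0 <= q <= N, heat_scalar_ge sigma N X &
      0 < q -> exists2 S : R, 0 < S & forall x : X,
        concave_in (forward_region_from S)
          (fun t s => heat_nash N x t s + q / 2 * ln t)].

Definition forward_comparison (N q : R) (X : mmd_data R) : Prop :=
  forall x : X, concave_in forward_region
    (fun t s => heat_nash N x t s + q / 2 * ln t).

End comparison.

Section convergence.
Context {R : realType}.

(* A realization of the pointed measured Gromov-Hausdorff convergence by
   isometric embeddings into a metric space [Z]. *)
Record pmGH_realization (X_ : nat -> mmd_data R) (x_ : forall n, X_ n)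
    (X : mmd_data R) (x : X) (Z : metricType R)
    (i_ : forall n, X_ n -> Z) (i : X -> Z) : Prop := {
  pmGH_isometry_seq : forall n (y z : X_ n),
    mdist (i_ n y) (i_ n z) = dist (X_ n) y z ;
  pmGH_isometry : forall y z : X, mdist (i y) (i z) = dist X y z ;
  pmGH_base : i_ n (x_ n) @[n --> \oo] --> i x ;
  pmGH_ball_seq : forall r e : R, 0 < r -> 0 < e -> \forall n \near \oo,
    forall y : X_ n, dist (X_ n) (x_ n) y <= r ->
      exists z : X, mdist (i_ n y) (i z) < e ;
  pmGH_ball : forall r e : R, 0 < r -> 0 < e -> \forall n \near \oo,
    forall z : X, dist X x z <= r ->
      exists y : X_ n, mdist (i z) (i_ n y) < e ;
  pmGH_measure : forall phi : Z -> R, continuous phi ->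
    (exists M : R, forall z, `|phi z| <= M) ->
    (exists r : R, forall z, r < mdist (i x) z -> phi z = 0) ->
    mmd_integral (phi \o i_ n) @[n --> \oo] --> mmd_integral (phi \o i) }.

Definition entropy_heat_cvg (N : R) (X_ : nat -> mmd_data R)
    (x_ : forall n, X_ n) (X : mmd_data R) (x : X) : Prop :=
  (forall n, is_mmd (X_ n) N) /\ is_mmd X N /\
  exists (Z : metricType R) (i_ : forall n, X_ n -> Z) (i : X -> Z),
    pmGH_realization x_ x i_ i /\
    forall (z_ : forall n, X_ n) (z : X), i_ n (z_ n) @[n --> \oo] --> i z ->
      (forall K : set R, compact K -> K `<=` [set t | 0 < t] ->
         {uniform K, (fun n t => nash N t (z_ n)) @ \oo -->
                     (fun t => nash N t z)}) /\
      (forall K : set (R * R), compact K ->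
         K `<=` [set u | 0 < u.1 /\ 0 < u.2] ->
         {uniform K, (fun n u => heat_nash N (z_ n) u.1 u.2) @ \oo -->
                     (fun u => heat_nash N z u.1 u.2)}).

End convergence.
Arguments entropy_heat_cvg {R} N X_ x_ X x.

Section lebesgue_rV.
Context {R : realType}.

Definition cons_rV m (u : R * borel 'rV[R]_m) : borel 'rV[R]_m.+1 :=
  \row_j (if unlift ord0 j is Some k then (u.2 : 'rV[R]_m) ord0 k else u.1).

Lemma measurable_cons_rV m : measurable_fun setT (@cons_rV m).
Proof.
apply: (@measurability _ _ _ _ setT (@cons_rV m) (@open 'rV[R]_m.+1)) => //.
move=> _ [U oU <-]; rewrite setTI.
pose bx (ab : 'rV[rat]_m.+1 * 'rV[rat]_m.+1) : set 'rV[R]_m.+1 :=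
  [set v | forall j, v ord0 j \in `](ratr (ab.1 ord0 j)), (ratr (ab.2 ord0 j))[].
pose F n := if unpickle n is Some ab then
   if `[< bx ab `<=` U >] then @cons_rV m @^-1` bx ab else set0 else set0.
have -> : @cons_rV m @^-1` U = \bigcup_n F n.
  apply/seteqP; split=> [u /= Uu|u [n _]]; last first.
    by rewrite /F; case: unpickle => // ab; case: asboolP => // abU /abU.
  have /nbhs_ballP[e /= e0 eU] : nbhs (cons_rV u : 'rV[R]_m.+1) U.
    exact: open_nbhs_nbhs.
  pose v : 'rV[R]_m.+1 := cons_rV u.
  have lo j : {q : rat | ratr q \in `](v ord0 j - e), (v ord0 j)[}.
    by apply/cid/rat_in_itvoo; rewrite ltrBlDr ltrDl.
  have hi j : {q : rat | ratr q \in `](v ord0 j), (v ord0 j + e)[}.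
    by apply/cid/rat_in_itvoo; rewrite ltrDl.
  pose ab := (\row_j sval (lo j), \row_j sval (hi j)).
  exists (pickle ab) => //; rewrite /F pickleK.
  have abU : bx ab `<=` U.
    move=> w /= bw; apply: eU; split => // i j; rewrite (ord1 i) -/v.
    move: (bw j) (svalP (lo j)) (svalP (hi j)).
    rewrite /= [in X in X -> _]mxE [in X in X -> _]mxE !in_itv/=.
    rewrite /ball /= ltr_norml.
    by move=> /andP[w1 w2] /andP[a1 a2] /andP[b1 b2]; apply/andP; split; lra.
  case: asboolP => // _ j; rewrite -/v.
  move: (svalP (lo j)) (svalP (hi j)); rewrite !in_itv/= => /andP[_ a2] /andP[b1 _].
  by rewrite [in X in X < _]mxE a2 [in X in _ < X]mxE.
apply: bigcupT_measurable => n; rewrite /F; case: unpickle => [ab|//].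
case: asboolP => // _.
pose C (j : 'I_m.+1) : set (R * borel 'rV[R]_m) :=
  [set u | (cons_rV u : 'rV[R]_m.+1) ord0 j \in
    `](ratr (ab.1 ord0 j)), (ratr (ab.2 ord0 j))[].
rewrite (_ : _ @^-1` _ = \bigcap_(j in [set: 'I_m.+1]) C j); last first.
  by apply/seteqP; split=> u /= => [H j _|H j]; exact: H.
apply: fin_bigcap_measurable => // j _; rewrite /C.
under eq_set do rewrite mxE.
case: (unliftP ord0 j) => [k _|_].
  have mk : measurable ([set v : 'rV[R]_m | v ord0 k \in
      `](ratr (ab.1 ord0 j)), (ratr (ab.2 ord0 j))[] : set (borel 'rV[R]_m)).
    apply: sub_sigma_algebra; rewrite openE => v /= vI.
    have : open [set` `](ratr (ab.1 ord0 j) : R), (ratr (ab.2 ord0 j) : R)[].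
      exact: interval_open.
    rewrite openE => /(_ _ vI) /nbhs_ballP[e /= e0 eI].
    apply/nbhs_ballP; exists e => // w [_ vw]; apply: eI; exact: vw.
  have := @measurable_snd _ _ R (borel 'rV[R]_m) measurableT _ mk.
  by rewrite setTI.
have := @measurable_fst _ _ R (borel 'rV[R]_m) measurableT
  [set` `](ratr (ab.1 ord0 j) : R), (ratr (ab.2 ord0 j) : R)[]
  (measurable_itv _).
by rewrite setTI.
Qed.


Section cons_measure.
Context m (lam : {sigma_finite_measure set (measurableTypeR R) -> \bar R})
  (mu : {sigma_finite_measure set (borel 'rV[R]_m) -> \bar R}).

Definition cons_measure : set (borel 'rV[R]_m.+1) -> \bar R :=
  pushforward (lam \x mu)%E (@cons_rV m).

Let cons_measure0 : cons_measure set0 = 0%E.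
Proof. by rewrite /cons_measure /pushforward preimage_set0 measure0. Qed.

Let cons_measure_ge0 A : (0 <= cons_measure A)%E.
Proof. by rewrite /cons_measure /pushforward measure_ge0. Qed.

Let cons_measure_sigma_additive : semi_sigma_additive cons_measure.
Proof.
move=> F mF tF mUF; rewrite /cons_measure /pushforward preimage_bigcup.
have mcons A : measurable A -> measurable (@cons_rV m @^-1` A).
  by move=> mA; rewrite -[X in measurable X]setTI; exact: measurable_cons_rV.
apply: measure_semi_sigma_additive.
- by move=> n; exact: mcons.
- apply/trivIsetP => /= i j _ _ ij; rewrite -preimage_setI.
  by move/trivIsetP : tF => /(_ _ _ _ _ ij) ->//; rewrite preimage_set0.
- by rewrite -preimage_bigcup; exact: mcons.
Qed.

HB.instance Definition _ := isMeasure.Build _ _ _ cons_measure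
  cons_measure0 cons_measure_ge0 cons_measure_sigma_additive.

Let cons_measure_sigma_finite : sigma_finite setT cons_measure.
Proof.
pose hd (v : borel 'rV[R]_m.+1) : R := (v : 'rV[R]_m.+1) ord0 ord0.
pose tl (v : borel 'rV[R]_m.+1) : borel 'rV[R]_m :=
  \row_k (v : 'rV[R]_m.+1) ord0 (lift ord0 k).
have mhd : measurable_fun setT hd.
  apply: (measurability _ (measurable_realfun.RGenOpens.measurableE R)) => //.
  move=> _ [_ [a [b ->] <-]]; rewrite setTI; apply: sub_sigma_algebra.
  rewrite openE => v /= vI.
  have : open `]a, b[%classic by exact: interval_open.
  rewrite openE => /(_ _ vI) /nbhs_ballP[e /= e0 eI].
  by apply/nbhs_ballP; exists e => // w [_ vw]; apply: eI; exact: vw.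
have mtl : measurable_fun setT tl.
  apply: (@measurability _ _ _ _ setT tl (@open 'rV[R]_m)) => //.
  move=> _ [U oU <-]; rewrite setTI; apply: sub_sigma_algebra.
  rewrite openE => v /= vU; move: oU; rewrite openE => /(_ _ vU).
  move=> /nbhs_ballP[e /= e0 eU]; apply/nbhs_ballP; exists e => // w [_ vw].
  by apply: eU; split => // i j; rewrite !mxE; exact: vw.
have /sigma_finiteP[F [TF ndF Foo]] := sigma_finiteT lam.
have /sigma_finiteP[G [TG ndG Goo]] := sigma_finiteT mu.
pose f v := (hd v, tl v).
have mf : measurable_fun setT f by exact: measurable_fun_pair.
have fK : cancel (@cons_rV m) f.
  move=> [x v]; rewrite /f /hd /tl mxE unlift_none; congr pair.
  by apply/rowP => k; rewrite !mxE liftK.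
exists (fun n => f @^-1` (F n `*` G n)).
  rewrite -preimage_bigcup (_ : \bigcup_n _ = setT) ?preimage_setT//.
  apply/seteqP; split => // -[x v] _.
  have : [set: measurableTypeR R] x by [].
  have : [set: borel 'rV[R]_m] v by [].
  rewrite {1}TF {1}TG => -[k _ Gv] [n _ Fx]; exists (maxn n k) => //; split.
    by move: x Fx; exact/subsetPset/ndF/leq_maxl.
  by move: v Gv; exact/subsetPset/ndG/leq_maxr.
move=> n; have [mFn Fnoo] := Foo n; have [mGn Gnoo] := Goo n; split.
  by rewrite -[X in measurable X]setTI; apply: mf => //; exact: measurableX.
rewrite /cons_measure /pushforward -comp_preimage (_ : f \o _ = id).
  rewrite preimage_id product_measure1E// lte_mul_pinfty// ge0_fin_numE//.
by apply/funext => u; exact: fK.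
Qed.

HB.instance Definition _ := Measure_isSigmaFinite.Build _ _ _ cons_measure
  cons_measure_sigma_finite.

End cons_measure.

(* The m-fold product of the Lebesgue measure on R, as a measure on the Borel
   sets of R^m. *)
Fixpoint lebesgue_rV m : {sigma_finite_measure set (borel 'rV[R]_m) -> \bar R} :=
  if m is m'.+1 then cons_measure lebesgue_measure (lebesgue_rV m')
  else \d_(0 : borel 'rV[R]_0).

End lebesgue_rV.

Section euclidean_space.
Context {R : realType}.

Fixpoint Ck m (k : nat) (f : 'rV[R]_m -> R) : Prop :=
  continuous f /\
  if k is k'.+1 then
    forall j : 'I_m, (forall v, derivable f v (delta_mx ord0 j)) /\
      Ck k' ('D_(delta_mx ord0 j) f)
  else True.

(* Smooth functions with compact support. *)
Definition test_function m (phi : 'rV[R]_m -> R) : Prop :=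
  (forall k, Ck k phi) /\
  exists K : set 'rV[R]_m, compact K /\ forall v, ~ K v -> phi v = 0.

Definition is_weak_partial m (j : 'I_m) (f g : 'rV[R]_m -> R) : Prop :=
  (g : borel 'rV[R]_m -> R) \in Lfun (lebesgue_rV m) 2%:E /\
  forall phi, test_function phi ->
    \int[lebesgue_rV m]_v (f v * 'D_(delta_mx ord0 j) phi v) =
    - \int[lebesgue_rV m]_v (g v * phi v).

Definition weak_partial m (j : 'I_m) (f : 'rV[R]_m -> R) : 'rV[R]_m -> R :=
  xget (fun _ => 0) (is_weak_partial j f).

(* H^1(R^m) with the form \int |grad f|^2 c dL^m. *)
Definition euclid (m : nat) (c : {posnum R}) : mmd_data R :=
  let L := mscale c%:num%:nng (lebesgue_rV m) in
  {| carrier := 'rV[R]_m ;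
     dist := fun v w => Num.sqrt (\sum_j (v ord0 j - w ord0 j) ^+ 2) ;
     refm := L ;
     dom := [set f | (f : borel 'rV[R]_m -> R) \in Lfun (lebesgue_rV m) 2%:E /\
       forall j, exists g, is_weak_partial j f g] ;
     form := fun f g =>
       \int[L]_v (\sum_j weak_partial j f v * weak_partial j g v) |}.

End euclidean_space.

(* Main.v *)
Require Import Defs.
From HB Require Import structures.
From mathcomp Require Import all_boot all_order all_algebra.
From mathcomp Require Import all_classical all_reals all_analysis.
From mathcomp Require Import measurable_realfun ring lra.
Import Order.TTheory GRing.Theory Num.Theory.
Import numFieldNormedType.Exports.
Local Open Scope classical_set_scope.
Local Open Scope ring_scope.

Set Implicit Arguments.
Unset Strict Implicit.
Unset Printing Implicit Defensive.

(** The heat flow of a Dirichlet form is unique, since the squared L^2 norm of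
    the difference of two flows has nonpositive derivative and tends to 0 at
    time 0; by continuity and full support the heat kernel is unique as well.
    Hence a bijection which multiplies the measure and the form by constants
    transports the heat kernel, up to a factor and a change of time, and changes
    the Nash entropies only by an additive constant and the same change of time.

    For a rescaling by a this turns the comparison on t >= S into the comparison
    on t >= a^2 S, and a -> 0 yields the exact forward comparison; it is
    invariant under rescaling, so it passes to further limits.

    For the homotheties of R^m it shows, without computing the heat kernel, that
    the Nash entropy is (m - N) / 2 * log t plus a constant. Then
    (m - N + q) / 2 * log t is concave along inverse-time geodesics, where log t
    is strictly convex, whence m <= N - q. The form of R^m is defined by a choice
    of weak derivatives, so its behaviour under homotheties relies on their
    uniqueness, proved by testing against products of bump functions. *)

(** * Uniqueness of the heat flow *)

(** [heat_kernel] is picked by [xget], so the kernels of a space and of its rescaling are unrelated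
    until uniqueness is known. A flow is determined only almost everywhere, whereas a Nash entropy
    uses the kernel at one given pole. Continuity and full support bridge this gap: two different
    kernels would differ with constant sign on a product of open sets, and the indicator of one
    factor would separate the flows.

    Multiplying the measure by one constant and the form by another multiplies the generator, hence
    time, by a quotient in which c cancels; for a rescaling by a this leaves the factor a^2.
    Dividing both times by a constant preserves inverse-time geodesics and shifts log t by a
    constant, so concavity survives. A fixed geodesic keeps t above a positive bound, so its
    dilation by 1 / a^2 ends up in t >= S.

    On R^m the single map v -> sqrt t * v + x carries the pole 0 at time 1 to the pole x at time t,
    which gives at once the independence of the pole and the dependence on time. Along a geodesic 1
    / t is affine, so log t = - log (1 / t) is strictly convex unless t is constant. *)

Section L2_theory.
Context d (T : measurableType d) (R : realType).
Variable mu : {measure set T -> \bar R}.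
Implicit Types (f g h : T -> R) (a b : R).

Local Notation L2 := (Lfun mu 2%:E).

Definition L2dot f g : R := \int[mu]_x (f x * g x).

Lemma Lnorm2E f :
  ('N[mu]_(2%:E)[EFin \o f] = (\int[mu]_x (f x ^+ 2)%:E) `^ 2^-1)%E.
Proof.
rewrite unlock; congr (_ `^ _)%E; apply: eq_integral => x _ /=.
by rewrite (@powR_mulrn _ `|f x| 2%N)// real_normK// num_real.
Qed.

Lemma L2P f : f \in L2 <->
  measurable_fun setT f /\ (\int[mu]_x (f x ^+ 2)%:E < +oo)%E.
Proof.
split=> [L2f|[mf foo]].
  have [mf _] : measurable_fun setT f /\ True.
    by move: L2f; rewrite inE => /andP[/[!inE]/= mf _].
  split=> //; have /integrableP[_] := Lfun2_integrable_sqr L2f.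
  apply: le_lt_trans; rewrite le_eqVlt; apply/orP; left; apply/eqP.
  by apply: eq_integral => x _ /=; rewrite ger0_norm// sqr_ge0.
apply/andP; split; rewrite inE//= /finite_norm Lnorm2E.
exact: poweR_lty.
Qed.

Lemma L2_measurable f : f \in L2 -> measurable_fun setT f.
Proof. by move=> /L2P[]. Qed.

Lemma L2_mul_integrable f g : f \in L2 -> g \in L2 ->
  mu.-integrable setT (fun x => (f x * g x)%:E).
Proof.
by move=> fL gL; have := Lfun2_mul_Lfun1 fL gL => /Lfun1_integrable.
Qed.

Lemma L2_lin a f g : f \in L2 -> g \in L2 -> (fun x => a * f x + g x) \in L2.
Proof.
have l12 : (1 <= 2%:E :> \bar R)%E by rewrite lee_fin ler1n.
exact: (proj2 (@Lfun_submod_closed _ _ _ mu _ l12)).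
Qed.

Lemma L2_quotient a f g h : f \in L2 -> g \in L2 -> h \in L2 ->
  (fun x => a * (f x - g x) - h x) \in L2.
Proof.
move=> fL gL hL.
have -> : (fun x => a * (f x - g x) - h x) = (fun x => (-1) * h x +
    (a * (fun x => (-1) * g x + f x) x + (fun x => (-1) * h x + h x) x)).
  by apply/funext => x; ring.
by apply: L2_lin => //; apply: L2_lin; exact: L2_lin.
Qed.

Lemma L2dotC f g : L2dot f g = L2dot g f.
Proof. by apply: eq_Rintegral => x _; rewrite mulrC. Qed.

Lemma L2dotDl a f g h : f \in L2 -> g \in L2 -> h \in L2 ->
  L2dot (fun x => a * f x + g x) h = a * L2dot f h + L2dot g h.
Proof.
move=> fL gL hL; have ifh := L2_mul_integrable fL hL.
have igh := L2_mul_integrable gL hL.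
rewrite /L2dot -RintegralZl// -RintegralD//=; last exact: integrableZl ifh.
by apply: eq_Rintegral => x _; ring.
Qed.

Lemma L2dotDr a f g h : f \in L2 -> g \in L2 -> h \in L2 ->
  L2dot h (fun x => a * f x + g x) = a * L2dot h f + L2dot h g.
Proof. by move=> *; rewrite L2dotC L2dotDl// !(L2dotC h). Qed.

Lemma L2dot_ge0 f : 0 <= L2dot f f.
Proof. by apply: Rintegral_ge0 => x _; rewrite -expr2 sqr_ge0. Qed.

Lemma L2dot_lin2 a f g : f \in L2 -> g \in L2 ->
  L2dot (fun x => a * f x + g x) (fun x => a * f x + g x) =
  a ^+ 2 * L2dot f f + 2 * a * L2dot f g + L2dot g g.
Proof.
move=> fL gL; have L := L2_lin a fL gL.
by rewrite L2dotDl// !L2dotDr// (L2dotC g f); ring.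
Qed.

Lemma L2dot_CS f g : f \in L2 -> g \in L2 ->
  L2dot f g ^+ 2 <= L2dot f f * L2dot g g.
Proof.
move=> fL gL; have [g0|g0] := eqVneq (L2dot g g) 0.
  rewrite g0 mulr0.
  (* A nonnegative affine function of [a] has slope 0: otherwise the value of [a] chosen below would
     make it -1. *)
  have H a : 0 <= L2dot f f + 2 * a * L2dot f g.
    have := L2dot_ge0 (fun x => a * g x + f x).
    by rewrite L2dot_lin2// g0 mulr0 add0r addrC (L2dotC g f).
  suff -> : L2dot f g = 0 by rewrite expr0n.
  apply/eqP/negPn/negP => fg0.
  have := H (- (L2dot f f + 1) / (2 * L2dot f g)).
  suff -> : 2 * (- (L2dot f f + 1) / (2 * L2dot f g)) * L2dot f g =
    - (L2dot f f + 1) by lra.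
  by field; rewrite fg0.
have gp : 0 < L2dot g g by rewrite lt_neqAle eq_sym g0 L2dot_ge0.
(* The coefficient minimizes the quadratic polynomial |a g + f|^2. *)
have := L2dot_ge0 (fun x => (- L2dot f g / L2dot g g) * g x + f x).
rewrite L2dot_lin2// (L2dotC g f) -(@pmulr_rge0 _ (L2dot g g))//.
set D := L2dot f g; set F := L2dot f f; set G := L2dot g g.
suff -> : G * ((- D / G) ^+ 2 * G + 2 * (- D / G) * D + F) = F * G - D ^+ 2.
  by rewrite subr_ge0.
by field.
Qed.

Lemma L2dot_sqr_le f g : f \in L2 -> g \in L2 ->
  L2dot (fun x => f x + g x) (fun x => f x + g x) <=
  2 * L2dot f f + 2 * L2dot g g.
Proof.
move=> fL gL; have H a : 0 <= a ^+ 2 * L2dot f f + 2 * a * L2dot f g + L2dot g g.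
  by rewrite -L2dot_lin2// L2dot_ge0.
have -> : (fun x => f x + g x) = (fun x => 1 * f x + g x).
  by apply/funext => x; rewrite mul1r.
by rewrite L2dot_lin2//; have := H (-1); lra.
Qed.

Lemma L2dot_eq0 f : f \in L2 -> L2dot f f = 0 ->
  {ae mu, forall x, f x = 0}.
Proof.
move=> fL f0; have /L2P[mf foo] := fL.
have mf2 : measurable_fun setT (fun x => (f x ^+ 2)%:E : \bar R).
  by apply/measurable_EFinP; exact: measurable_funX.
have I0 : (\int[mu]_x `|(f x ^+ 2)%:E| = 0)%E.
  have -> : (\int[mu]_x `|(f x ^+ 2)%:E| = \int[mu]_x (f x ^+ 2)%:E)%E.
    by apply: eq_integral => x _; rewrite gee0_abs// lee_fin sqr_ge0.
  rewrite -[LHS]fineK; last first.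
    by rewrite ge0_fin_numE// integral_ge0// => x _; rewrite lee_fin sqr_ge0.
  congr EFin; rewrite -[RHS]f0 /L2dot /Rintegral.
  by congr fine; apply: eq_integral => x _; rewrite expr2.
have /ae_eq_integral_abs H := I0.
apply: filterS (H measurableT mf2) => x /(_ I) [] /eqP.
by rewrite sqrf_eq0 => /eqP.
Qed.

Lemma Lnorm2_dot f : f \in L2 ->
  ('N[mu]_(2%:E)[EFin \o f] = (Num.sqrt (L2dot f f))%:E)%E.
Proof.
move=> /L2P[mf foo]; rewrite Lnorm2E.
have -> : (\int[mu]_x (f x ^+ 2)%:E = (L2dot f f)%:E)%E.
  rewrite -[LHS]fineK; last first.
    by rewrite ge0_fin_numE// integral_ge0// => x _; rewrite lee_fin sqr_ge0.
  by congr EFin; congr fine; apply: eq_integral => x _; rewrite expr2.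
by rewrite /= powR12_sqrt// L2dot_ge0.
Qed.

(** Passes from the extended-real norms of [is_heat_flow] to real squared norms, on which
    derivatives can be computed. *)
Lemma Lnorm2_cvg0 (S : Type) (F : set_system S) {FF : Filter F} (f_ : S -> T -> R) :
  (\forall s \near F, f_ s \in L2) ->
  ('N[mu]_(2%:E)[EFin \o f_ s] @[s --> F] --> 0)%E ->
  L2dot (f_ s) (f_ s) @[s --> F] --> 0.
Proof.
move=> fL f0.
have H : Num.sqrt (L2dot (f_ s) (f_ s)) @[s --> F] --> 0.
  have H1 : fine 'N[mu]_(2%:E)[EFin \o f_ s] @[s --> F] --> fine 0%E.
    exact: fine_cvg.
  apply: cvg_trans H1; apply: near_eq_cvg.
  by apply: filterS fL => s fs; rewrite Lnorm2_dot.
have -> : (fun s => L2dot (f_ s) (f_ s)) =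
    (fun s => Num.sqrt (L2dot (f_ s) (f_ s)) * Num.sqrt (L2dot (f_ s) (f_ s))).
  by apply/funext => s; rewrite -expr2 sqr_sqrtr// L2dot_ge0.
by rewrite -[X in _ --> X](mulr0 0); exact: cvgM.
Qed.

End L2_theory.

Section L2_flow.
Context d (T : measurableType d) (R : realType).
Variable mu : {measure set T -> \bar R}.
Local Notation L2 := (Lfun mu 2%:E).
Local Notation dot := (L2dot mu).

(** The derivative of |w|^2 is 2 <w', w>; the difference quotient is written as in the definition of
    [derivable]. *)
Lemma L2_flow_derive (w : R -> T -> R) (t : R) (v : T -> R) :
  w t \in L2 -> v \in L2 -> (\forall h \near 0^', w (t + h) \in L2) ->
  dot (fun x => h^-1 * (w (t + h) x - w t x) - v x)
      (fun x => h^-1 * (w (t + h) x - w t x) - v x) @[h --> 0^'] --> 0 ->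
  h^-1 *: (dot (w (h *: 1 + t)) (w (h *: 1 + t)) - dot (w t) (w t)) @[h --> 0^']
    --> 2 * dot v (w t).
Proof.
move=> wL vL whL.
pose r := fun (h : R) x => h^-1 * (w (t + h) x - w t x) - v x.
move=> r0.
have rL : \forall h \near 0^', r h \in L2.
  by apply: filterS whL => h whL; exact: L2_quotient.
(* Since w (t + h) = w t + h (r h + v), the quotient is 2 <v, w t> + 2 <r h, w t> + h |r h + v|^2.
   Cauchy-Schwarz and [L2dot_sqr_le] bound the last two terms by [b h]. *)
pose b h := `|h| * (2 * dot (r h) (r h) + 2 * dot v v)
            + 2 * Num.sqrt (dot (r h) (r h) * dot (w t) (w t)).
have b0 : b h @[h --> (0:R)^'] --> 0.
  rewrite [X in _ --> X](_ : 0 =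
    0 * (2 * 0 + 2 * dot v v) + 2 * Num.sqrt (0 * dot (w t) (w t))); last first.
    by rewrite !mul0r sqrtr0 mulr0 addr0.
  apply: cvgD; [apply: cvgM; [|apply: cvgD; [apply: cvgMr|exact: cvg_cst]]|].
  - by rewrite -[X in _ --> X](normr0 R); apply: cvg_norm; exact: nbhs_dnbhs.
  - by [].
  - apply: cvgMr.
    apply: (@cvg_comp _ _ _ (fun h => dot (r h) (r h) * dot (w t) (w t))
      Num.sqrt _ (nbhs (0 * dot (w t) (w t)))).
      exact: cvgMl.
    exact: sqrt_continuous.
apply/cvgrPdist_le => e e0.
have b0' : \forall h \near (0:R)^', b h <= e.
  have /cvgrPdist_le /(_ _ e0) := b0; apply: filterS => h.
  by rewrite sub0r normrN => /(le_trans (ler_norm _)).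
have hn0 : \forall h \near (0:R)^', h != 0 by exact: nbhs_dnbhs_neq.
near=> h.
have h0 : h != 0 by near: h.
have rhL : r h \in L2 by near: h.
apply: le_trans (_ : b h <= e); last by near: h.
have qL : (fun x => 1 * r h x + v x) \in L2 by exact: L2_lin.
have -> : w (h *: 1 + t) = fun x => h * (1 * r h x + v x) + w t x.
  apply/funext => x; rewrite /r [h *: 1]mulr1 addrC; field.
  by [].
rewrite L2dot_lin2//.
set q := fun x => _ + v x.
have -> : 2 * dot v (w t) - h^-1 *: (h ^+ 2 * dot q q + 2 * h * dot q (w t) +
    dot (w t) (w t) - dot (w t) (w t))
  = - (h * dot q q) - 2 * dot (r h) (w t).
  have -> : dot q (w t) = dot (r h) (w t) + dot v (w t).
    by rewrite /q L2dotDl// mul1r.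
  by rewrite -[h^-1 *: _]/(h^-1 * _); field.
rewrite (le_trans (ler_normB _ _))// normrN !normrM lerD//.
  rewrite ler_wpM2l//  ger0_norm ?L2dot_ge0//.
  by have := L2dot_sqr_le rhL vL; rewrite /q; under [in X in _ -> X]eq_fun do rewrite mul1r.
rewrite ger0_norm// ler_wpM2l// -sqrtr_sqr ler_wsqrtr//.
exact: L2dot_CS.
Unshelve. all: by end_near. Qed.

(** The condition [dot v (w t) <= 0] is dissipativity: for a heat flow, v is the generator applied
    to [w t] and the product is minus the form at [w t]. *)
Lemma L2_flow_eq0 (w : R -> T -> R) :
  (forall t : R, 0 < t -> w t \in L2) ->
  (forall t : R, 0 < t -> exists v, [/\ v \in L2, dot v (w t) <= 0 &
     dot (fun x => h^-1 * (w (t + h) x - w t x) - v x)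
      (fun x => h^-1 * (w (t + h) x - w t x) - v x) @[h --> 0^'] --> 0]) ->
  dot (w t) (w t) @[t --> 0^'+] --> 0 ->
  forall t : R, 0 < t -> {ae mu, forall x, w t x = 0}.
Proof.
move=> wL wd w0 t t0; apply: L2dot_eq0; first exact: wL.
pose E (t : R) := dot (w t) (w t).
have dE (s : R) : 0 < s -> exists2 l : R, l <= 0 &
    h^-1 *: (E (h *: 1 + s) - E s) @[h --> 0^'] --> l.
  move=> s0; have [v [vL v0 vc]] := wd s s0; exists (2 * dot v (w s)).
    by rewrite mulr_ge0_le0.
  apply: L2_flow_derive => //; first exact: wL.
  have : \forall h \near (0:R), 0 < s + h.
    have /(_ (0:R)) : continuous (fun h => s + h).
      by move=> x; apply: cvgD; [exact: cvg_cst|exact: cvg_id].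
    by move=> c; apply: (cvgr_gt _ c); rewrite addr0.
  by move=> /nbhs_dnbhs; apply: filterS => h; exact: wL.
have derE (s : R) : 0 < s -> derivable E s 1.
  by move=> s0; have [l _ lc] := dE _ s0; apply/cvg_ex; exists l.
(* Monotonicity is available at positive times only, where [E] is differentiable; time 0 enters
   through the limit [w0]. *)
have E_le (s : R) : 0 < s -> s <= t -> E t <= E s.
  move=> s0 st; have := @ler0_derive1_nincr R E s t.
  apply => // [x|x|].
  - by rewrite in_itv/= => /andP[sx _]; apply: derE; exact: lt_trans sx.
  - rewrite in_itv/= => /andP[sx _]; rewrite derive1E.
    have [l l0 lc] := dE x (lt_trans s0 sx).
    by rewrite /derive (cvg_lim _ lc).
  - apply: derivable_within_continuous => x; rewrite in_itv/= => /andP[sx _].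
    by apply: derE; exact: lt_le_trans sx.
apply/eqP; rewrite eq_le L2dot_ge0 andbT.
apply/ler_addgt0Pl => e e0; rewrite addr0.
have He : \forall s \near (0:R)^'+, E s <= e.
  have /cvgrPdist_le /(_ _ e0) := w0; apply: filterS => s.
  by rewrite sub0r normrN => /(le_trans (ler_norm _)).
near (0:R)^'+ => s.
apply: le_trans (_ : E s <= e); last by near: s.
apply: E_le; first by near: s; exact: nbhs_right_gt.
by near: s; exact: nbhs_right_le.
Unshelve. all: by end_near. Qed.

End L2_flow.

Lemma cvg_eqfun (S : Type) (V : topologicalType) (F : set_system S) (f g : S -> V) (l : V) :
  f =1 g -> f s @[s --> F] --> l -> g s @[s --> F] --> l.
Proof. by move=> /funext ->. Qed.

Section L2_sub.
Context d (T : measurableType d) (R : realType).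
Variable mu : {measure set T -> \bar R}.
Local Notation L2 := (Lfun mu 2%:E).
Local Notation dot := (L2dot mu).
Implicit Types f g : T -> R.

Lemma L2dot_sub_le f g : f \in L2 -> g \in L2 ->
  dot (fun x => (-1) * f x + g x) (fun x => (-1) * f x + g x) <=
  2 * dot f f + 2 * dot g g.
Proof.
move=> fL gL; have : 0 <= dot (fun x => 1 * f x + g x) (fun x => 1 * f x + g x).
  exact: L2dot_ge0.
by rewrite !L2dot_lin2//; lra.
Qed.

Lemma L2dot_sub_cvg0 (S : Type) (F : set_system S) {FF : Filter F}
    (f g : S -> T -> R) :
  (\forall s \near F, f s \in L2) -> (\forall s \near F, g s \in L2) ->
  dot (f s) (f s) @[s --> F] --> 0 -> dot (g s) (g s) @[s --> F] --> 0 ->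
  dot (fun x => (-1) * f s x + g s x) (fun x => (-1) * f s x + g s x) @[s --> F] --> 0.
Proof.
move=> fL gL f0 g0.
apply: (@squeeze_cvgr _ _ _ _ (cst 0)
  (fun s => 2 * dot (f s) (f s) + 2 * dot (g s) (g s))).
- apply: filterS2 fL gL => s fL gL.
  by rewrite L2dot_ge0/= L2dot_sub_le.
- exact: cvg_cst.
- rewrite [X in _ --> X](_ : 0 = 2 * 0 + 2 * 0 :> R) ?mulr0 ?addr0//.
  by rewrite -[X in _ --> X](addr0 0) -[X in _ --> X + _](mulr0 2) -[X in _ --> _ + X](mulr0 2);
    apply: cvgD; apply: cvgMr.
Qed.

End L2_sub.

Section heat_flow.
Context {R : realType} (X : mmd_data R).
Implicit Types (f g : X -> R).
Local Notation mu := (refm X).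

(** Differences are written (-1) * f + g, the shape on which [dom_linear], [form_linear] and
    [L2_lin] apply directly. *)
Lemma generator_sub f g (Lf Lg : X -> R) : Defs.symmetric_form X ->
  is_generator f Lf -> is_generator g Lg ->
  is_generator (fun x => (-1) * f x + g x) (fun x => (-1) * Lf x + Lg x).
Proof.
move=> hX [fD LfL fE] [gD LgL gE]; split; [exact: dom_linear|exact: L2_lin|].
move=> k kD; rewrite form_linear// fE// gE//.
have kL := dom_L2 hX kD.
rewrite /mmd_integral -!/(L2dot mu _ _).
by rewrite (@L2dotDr _ _ _ mu (-1) Lf Lg k)//; ring.
Qed.

Lemma heat_flow_unique f (u v : R -> X -> R) : Defs.symmetric_form X ->
  L2 f -> is_heat_flow f u -> is_heat_flow f v ->
  forall t : R, 0 < t -> ae_on setT (fun x => u t x = v t x).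
Proof.
move=> hX fL [u0 uE] [v0 vE] t t0.
have uL (s : R) : 0 < s -> L2 (u s).
  by move=> /uE[? [+ _ _] _]; exact: dom_L2.
have vL (s : R) : 0 < s -> L2 (v s).
  by move=> /vE[? [+ _ _] _]; exact: dom_L2.
have near_pos (s : R) : 0 < s -> \forall h \near (0:R)^', 0 < s + h.
  move=> s0; apply: nbhs_dnbhs.
  have c : (s + h) @[h --> (0:R)] --> s + 0.
    by apply: cvgD; [exact: cvg_cst|exact: cvg_id].
  by apply: (cvgr_gt _ c); rewrite addr0.
have subL f1 f2 : L2 f1 -> L2 f2 -> L2 (fun x => (-1) * f1 x + f2 x).
  exact: L2_lin.
have := @L2_flow_eq0 _ (borel X) R mu (fun s => fun x => (-1) * v s x + u s x).
move=> /(_ _ _ _ t t0) H.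
have {}H : {ae mu, forall x : borel X, (-1) * v t x + u t x = 0}.
  apply: H => [s s0|s s0|].
  - by apply: (subL); [exact: vL|exact: uL].
  - have [Lu uG uc] := uE s s0; have [Lv vG vc] := vE s s0.
    have [wD LwL wE] := generator_sub hX vG uG.
    exists (fun x => (-1) * Lv x + Lu x); split => //.
      (* The difference of the flows lies in the domain, so its generator can be tested against the
         difference itself. *)
      rewrite L2dotC -oppr_ge0; have := wE _ wD.
      by rewrite /mmd_integral -/(L2dot mu _ _) => <-; exact: form_ge0.
    have qL (z : R -> X -> R) (Lz : X -> R) : (forall r : R, 0 < r -> L2 (z r)) -> L2 Lz ->
       \forall h \near (0:R)^', L2 (fun x => h^-1 * (z (s + h) x - z s x) - Lz x).
      move=> zL LzL; apply: filterS (near_pos _ s0) => h sh.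
      by apply: L2_quotient => //; exact: zL.
    have LuL : L2 Lu by case: uG.
    have LvL : L2 Lv by case: vG.
    have /(Lnorm2_cvg0 (qL u Lu uL LuL)) uc' := uc.
    have /(Lnorm2_cvg0 (qL v Lv vL LvL)) vc' := vc.
    have H := L2dot_sub_cvg0 (qL v Lv vL LvL) (qL u Lu uL LuL) vc' uc'.
    apply: (cvg_eqfun _ (H _)) => h.
    by congr (L2dot mu _ _); apply/funext => x; ring.
  - have qL (z : R -> X -> R) : (forall r : R, 0 < r -> L2 (z r)) ->
       \forall r \near (0:R)^'+, L2 (z r \- f).
      move=> zL; near=> r.
      have -> : z r \- f = fun x => (-1) * f x + z r x.
        by apply/funext => x /=; ring.
      by apply: (subL) => //; apply: zL; near: r; exact: nbhs_right_gt.
    have /(Lnorm2_cvg0 (qL u uL)) uc' := u0.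
    have /(Lnorm2_cvg0 (qL v vL)) vc' := v0.
    have H := L2dot_sub_cvg0 (qL v vL) (qL u uL) vc' uc'.
    apply: (cvg_eqfun _ (H _)) => h.
    by congr (L2dot mu _ _); apply/funext => x /=; ring.
by apply: filterS H => x + _; lra.
Unshelve. all: by end_near. Qed.

End heat_flow.

Section borel_measurable.

Lemma continuous_measurable_borel (S T : ptopologicalType) (f : S -> T) :
  continuous f -> measurable_fun setT (f : borel S -> borel T).
Proof.
move=> cf; apply: (@measurability _ _ (borel S) (borel T) setT f (@open T)) => //.
move=> _ [U oU <-]; rewrite setTI; apply: sub_sigma_algebra.
by apply: open_comp => // x _; exact: cf.
Qed.

Lemma continuous_measurable_real (R : realType) (S : ptopologicalType) (f : S -> R) :
  continuous f -> measurable_fun setT (f : borel S -> R).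
Proof.
move=> cf.
apply: (measurability _ (measurable_realfun.RGenOpens.measurableE R)) => //.
move=> _ [_ [a [b ->] <-]]; rewrite setTI; apply: sub_sigma_algebra.
apply: open_comp => [x _|]; [exact: cf|exact: interval_open].
Qed.

End borel_measurable.

Section scale_filter.
Context {R : realType}.

Lemma cvg_scale_at_right (l : R) : 0 < l ->
  l * t @[t --> (0:R)^'+] --> (0:R)^'+.
Proof.
move=> l0 A [e /= e0 eA]; exists (e / l) => /=; first by rewrite divr_gt0.
move=> t /=; rewrite sub0r normrN => te t0; apply: eA => /=; last exact: mulr_gt0.
by rewrite sub0r normrN normrM gtr0_norm// mulrC -ltr_pdivlMr.
Qed.

Lemma cvg_scale_dnbhs (l : R) : 0 < l ->
  l * t @[t --> (0:R)^'] --> (0:R)^'.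
Proof.
move=> l0 A [e /= e0 eA]; exists (e / l) => /=; first by rewrite divr_gt0.
move=> t /=; rewrite sub0r normrN => te t0; apply: eA => /=.
  by rewrite sub0r normrN normrM gtr0_norm// mulrC -ltr_pdivlMr.
by rewrite mulf_neq0// gt_eqF.
Qed.

End scale_filter.

(** * Similarities and heat kernels *)

Section scaled_pushforward.
Context d1 d2 (T1 : measurableType d1) (T2 : measurableType d2) (R : realType).
Variables (mu1 : {measure set T1 -> \bar R}) (mu2 : {measure set T2 -> \bar R}).
Variables (phi : T1 -> T2) (b : {posnum R}).
Hypothesis mphi : measurable_fun setT phi.
Hypothesis mu12 : forall A : set T2, measurable A ->
  mu1 (phi @^-1` A) = (b%:num%:E * mu2 A)%E.

Lemma ge0_integral_scaled (f : T2 -> \bar R) : measurable_fun setT f ->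
  (forall y, 0 <= f y)%E ->
  (\int[mu1]_x f (phi x) = b%:num%:E * \int[mu2]_y f y)%E.
Proof.
move=> mf f0.
have -> : (b%:num%:E * \int[mu2]_y f y)%E =
    (\int[mscale (b%:num%:nng)%R mu2]_y f y)%E.
  by rewrite ge0_integral_mscale.
rewrite -[LHS](@ge0_integral_pushforward _ _ T1 T2 R phi mphi mu1 setT f)//.
by apply: eq_measure_integral => A mA _; exact: mu12.
Qed.

(** Integrability is not assumed: if the positive or the negative part has infinite integral, [fine]
    turns both sides into 0. *)
Lemma Rintegral_scaled (f : T2 -> R) : measurable_fun setT f ->
  \int[mu1]_x f (phi x) = b%:num * \int[mu2]_y f y.
Proof.
move=> mf; rewrite /Rintegral.
have mf' : measurable_fun setT (fun y => (f y)%:E) by exact/measurable_EFinP.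
rewrite integralE [X in _ = _ * fine X]integralE.
have Hp := ge0_integral_scaled (measurable_funepos mf') (funepos_ge0 _).
have Hn := ge0_integral_scaled (measurable_funeneg mf') (funeneg_ge0 _).
transitivity (fine (b%:num%:E * \int[mu2]_y ((fun y => (f y)%:E)^\+ y) -
  b%:num%:E * \int[mu2]_y ((fun y => (f y)%:E)^\- y))%E).
  by rewrite -Hp -Hn; congr (fine (_ - _)); apply: eq_integral => x _; rewrite ?funeposE ?funenegE.
set p := (\int[_]_(_ in _) _)%E; set n := (\int[_]_(_ in _) _)%E.
have : (0 <= n)%E by exact: integral_ge0.
have : (0 <= p)%E by exact: integral_ge0.
have b0 : b%:num != 0 by [].
have bpos : 0 < b%:num by [].
move: p n => [p| |] [n| |]//= _ _; rewrite ?gt0_muley ?lte_fin//= ?mulr0//.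
by rewrite mulrBr.
Qed.

Lemma L2_integral_scaled (a : R) (f : T2 -> R) : measurable_fun setT f ->
  (\int[mu1]_x ((a * f (phi x)) ^+ 2)%:E =
   (a ^+ 2 * b%:num)%:E * \int[mu2]_y ((f y) ^+ 2)%:E)%E.
Proof.
move=> mf.
have mf2 : measurable_fun setT (fun y => ((f y) ^+ 2)%:E).
  by apply/measurable_EFinP; exact: measurable_funX.
rewrite (@ge0_integral_scaled (fun y => ((a * f y) ^+ 2)%:E)); last 2 first.
- by apply/measurable_EFinP; apply: measurable_funX; exact: measurable_funM.
- by move=> y; rewrite lee_fin sqr_ge0.
rewrite [in RHS]mulrC EFinM -muleA; congr (_ * _)%E.
under eq_integral do rewrite exprMn EFinM.
by rewrite ge0_integralZl_EFin// ?sqr_ge0// => y _; rewrite lee_fin sqr_ge0.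
Qed.

Lemma L2_scaled (f : T2 -> R) : f \in Lfun mu2 2%:E -> f \o phi \in Lfun mu1 2%:E.
Proof.
move=> /L2P[mf foo]; apply/L2P; split; first exact: measurableT_comp.
have -> : (\int[mu1]_x ((f \o phi) x ^+ 2)%:E = \int[mu1]_x ((1 * f (phi x)) ^+ 2)%:E)%E.
  by apply: eq_integral => x _ /=; rewrite mul1r.
by rewrite L2_integral_scaled// lte_mul_pinfty// lee_fin mulr_ge0// sqr_ge0.
Qed.

End scaled_pushforward.

Section similarity.
Context {R : realType}.

(** The heat flow is governed by the measure and the form, and the continuity of its kernel by the
    topology; these are the structures that must correspond. The instances are the identity from a
    space to its rescaling and the homotheties of R^m. *)
Record similarity (X Y : mmd_data R) (phi : X -> Y) (psi : Y -> X)
    (b k : {posnum R}) : Prop := {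
  simK : cancel phi psi ;
  simVK : cancel psi phi ;
  sim_continuous : continuous phi ;
  simV_continuous : continuous psi ;
  sim_refm : forall A : set (borel Y), measurable A ->
    refm X (phi @^-1` A) = (b%:num%:E * refm Y A)%E ;
  sim_dom : forall f, dom Y f <-> dom X (f \o phi) ;
  sim_form : forall f g, dom Y f -> dom Y g ->
    Defs.form X (f \o phi) (g \o phi) = k%:num * Defs.form Y f g }.

Context (X Y : mmd_data R) (phi : X -> Y) (psi : Y -> X) (b k : {posnum R}).
Hypothesis sim : similarity phi psi b k.

Lemma sim_measurable : measurable_fun setT (phi : borel X -> borel Y).
Proof.
apply: (@continuous_measurable_borel X Y phi).
exact: (sim_continuous sim).
Qed.

Lemma simV_measurable : measurable_fun setT (psi : borel Y -> borel X).
Proof.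
apply: (@continuous_measurable_borel Y X psi).
exact: (simV_continuous sim).
Qed.

Lemma sim_measurable_comp (f : Y -> R) : measurable_fun setT (f : borel Y -> R) ->
  measurable_fun setT (f \o phi : borel X -> R).
Proof.
move=> mf; apply: (@measurableT_comp _ _ _ (borel X) (borel Y) R f setT phi) => //.
exact: sim_measurable.
Qed.

Lemma sim_ge0_integral (f : borel Y -> \bar R) : measurable_fun setT f ->
  (forall y, 0 <= f y)%E ->
  (\int[refm X]_(x in [set: borel X]) f (phi x) =
   b%:num%:E * \int[refm Y]_(y in [set: borel Y]) f y)%E.
Proof.
exact: ge0_integral_scaled sim_measurable (sim_refm sim) f.
Qed.

Lemma sim_integral (f : Y -> R) : measurable_fun setT (f : borel Y -> R) ->
  mmd_integral (f \o phi) = b%:num * mmd_integral f.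
Proof.
exact: Rintegral_scaled sim_measurable (sim_refm sim) f.
Qed.

Lemma sim_integrable (f : Y -> R) : measurable_fun setT (f : borel Y -> R) ->
  (refm Y).-integrable setT (fun y : borel Y => (f y)%:E) ->
  (refm X).-integrable setT (fun x : borel X => (f (phi x))%:E).
Proof.
move=> mf /integrableP[mf' foo]; apply/integrableP; split.
  apply/measurable_EFinP.
  exact: sim_measurable_comp.
have -> : (\int[refm X]_(x in [set: borel X]) `|(f (phi x))%:E| =
   b%:num%:E * \int[refm Y]_(y in [set: borel Y]) `|(f y)%:E|)%E.
  apply: (@sim_ge0_integral (fun y => `|(f y)%:E|)%E) => //.
  exact: measurableT_comp.
by rewrite lte_mul_pinfty.
Qed.

Lemma sim_L2_integral (a : R) (f : Y -> R) :
  measurable_fun setT (f : borel Y -> R) ->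
  (\int[refm X]_(x in [set: borel X]) ((a * f (phi x)) ^+ 2)%:E =
   (a ^+ 2 * b%:num)%:E * \int[refm Y]_(y in [set: borel Y]) ((f y) ^+ 2)%:E)%E.
Proof.
exact: L2_integral_scaled sim_measurable (sim_refm sim) a f.
Qed.

Lemma sim_L2norm (a : R) (f : Y -> R) : measurable_fun setT (f : borel Y -> R) ->
  L2norm (fun x => a * f (phi x)) =
   (((a ^+ 2 * b%:num) `^ 2^-1)%:E * L2norm f)%E.
Proof.
move=> mf; rewrite /L2norm !Lnorm2E [X in (X `^ _)%E]sim_L2_integral//.
rewrite poweRM//; first by rewrite lee_fin mulr_ge0// sqr_ge0.
by apply: integral_ge0 => y _; rewrite lee_fin sqr_ge0.
Qed.

Lemma sim_L2 (f : Y -> R) : L2 f -> L2 (f \o phi).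
Proof.
exact: L2_scaled sim_measurable (sim_refm sim) f.
Qed.

Lemma simV_dom (g : X -> R) : dom X g -> dom Y (g \o psi).
Proof.
move=> gD; apply/(sim_dom sim).
by rewrite (_ : _ \o _ = g)//; apply/funext => x /=; rewrite (simK sim).
Qed.

Let lam := k%:num / b%:num.

(** The form on X is k times the form on Y, hence - k \int g Lf over Y, and this is - (k / b) \int
    (g Lf) \o phi over X. The quotient [lam] = k / b is therefore the factor of the generator, and
    so of time. *)
Lemma sim_generator (f Lf : Y -> R) : Defs.symmetric_form Y ->
  is_generator f Lf ->
  is_generator (f \o phi) (fun x => lam * Lf (phi x)).
Proof.
move=> hY [fD LfL fE]; split.
- exact/(sim_dom sim).
- have -> : (fun x => lam * Lf (phi x)) = (fun x => (lam - 1) * Lf (phi x) + Lf (phi x)).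
    by apply/funext => x; ring.
  by apply: L2_lin; exact: sim_L2.
- move=> g gD; have gYD := simV_dom gD.
  have {1}-> : g = (g \o psi) \o phi.
    by apply/funext => x /=; rewrite (simK sim).
  rewrite (sim_form sim)// fE// mulrN; congr (- _).
  have mg : measurable_fun setT (g \o psi : borel Y -> R).
    exact: L2_measurable (dom_L2 hY gYD).
  have mL : measurable_fun setT (Lf : borel Y -> R) by exact: L2_measurable LfL.
  have -> : mmd_integral (fun x => g x * (lam * Lf (phi x))) =
      mmd_integral ((fun y => g (psi y) * (lam * Lf y)) \o phi).
    by apply: eq_Rintegral => x _ /=; rewrite (simK sim).
  rewrite sim_integral; last first.
    apply: measurable_funM => //; exact: measurable_funM.
  have -> : mmd_integral (fun y => g (psi y) * (lam * Lf y)) =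
      lam * mmd_integral (fun y => g (psi y) * Lf y).
    rewrite /mmd_integral -RintegralZl//.
      by apply: eq_Rintegral => y _ /=; ring.
    exact: (L2_mul_integrable (dom_L2 hY gYD) LfL).
  by rewrite mulrA /lam [b%:num * _]mulrC divfK.
Qed.

Let lam0 : 0 < lam. Proof. by rewrite divr_gt0. Qed.

Lemma sim_heat_flow (f : Y -> R) (u : R -> Y -> R) : Defs.symmetric_form Y ->
  L2 f -> is_heat_flow f u ->
  is_heat_flow (f \o phi) (fun t x => u (lam * t) (phi x)).
Proof.
move=> hY fL [u0 uE].
have uL (s : R) : 0 < s -> L2 (u s).
  by move=> /uE[? [+ _ _] _]; exact: dom_L2.
have mf := L2_measurable fL.
split.
  have H := cvg_comp _ _ (cvg_scale_at_right lam0) u0.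
  have {}H := cvgeZl (isT : ((1 ^+ 2 * b%:num) `^ 2^-1)%:E \is a fin_num) H.
  rewrite mule0 in H; apply: cvg_trans H; apply: near_eq_cvg; near=> t.
  rewrite -sim_L2norm.
    by congr L2norm; apply/funext => x /=; rewrite mul1r.
  apply: measurable_funB => //; apply: L2_measurable; apply: uL.
  by rewrite mulr_gt0//; near: t; exact: nbhs_right_gt.
move=> t t0; have [v vG vc] := uE _ (mulr_gt0 lam0 t0).
exists (fun x => lam * v (phi x)); first exact: sim_generator.
(* The difference quotient on X with step h is [lam] times the one on Y with step [lam * h]. *)
have H := cvg_comp _ _ (cvg_scale_dnbhs lam0) vc.
have {}H := cvgeZl (isT : ((lam ^+ 2 * b%:num) `^ 2^-1)%:E \is a fin_num) H.
rewrite mule0 in H; apply: cvg_trans H; apply: near_eq_cvg.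
have tpos : \forall h \near (0:R)^', 0 < t + h.
  apply: nbhs_dnbhs.
  have c : (t + h) @[h --> (0:R)] --> t + 0.
    by apply: cvgD; [exact: cvg_cst|exact: cvg_id].
  by apply: (cvgr_gt _ c); rewrite addr0.
near=> h.
have th : 0 < t + h by near: h.
have h0 : h != 0 by near: h; exact: nbhs_dnbhs_neq.
have mv : measurable_fun setT (v : borel Y -> R).
  by case: vG => _ vL _; exact: L2_measurable vL.
rewrite -sim_L2norm.
  congr L2norm; apply/funext => x /=; rewrite (mulrDr lam t h); field.
  by rewrite h0 gt_eqF.
apply: measurable_funB => //; apply: measurable_funM => //.
apply: measurable_funB; apply: L2_measurable; apply: uL; last exact: mulr_gt0.
by rewrite -mulrDr mulr_gt0.
Unshelve. all: by end_near. Qed.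

End similarity.

(** * Comparison of continuous kernels *)

Section kernel_eq.
Context {R : realType} (X : mmd_data R).
Local Notation mu := (refm X).
Hypotheses (hd : metric_ax X) (hp : proper_dist X) (hr : radon X)
  (hs : full_support X).

Lemma open_dist_lt (x : X) (e : R) : open [set y | dist X x y < e].
Proof.
rewrite openE => y /= xy; apply/(dist_nbhs hd).
exists (e - dist X x y); first by rewrite subr_gt0.
move=> z /= yz; have := dist_triangle hd x y z; lra.
Qed.

Lemma open_dist_gt (x : X) (e : R) : open [set y | e < dist X x y].
Proof.
rewrite openE => y /= xy; apply/(dist_nbhs hd).
exists (dist X x y - e); first by rewrite subr_gt0.
move=> z /= yz; have := dist_triangle hd x z y; rewrite (dist_sym hd z y); lra.
Qed.

Lemma open_borel (U : set X) : open U -> measurable (U : set (borel X)).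
Proof. by move=> oU; exact: sub_sigma_algebra. Qed.

(** The open unit ball lies in the closed one, which is compact by properness and so has finite
    measure. *)
Lemma finite_measure_nbhs (x : X) :
  exists U : set X, [/\ open U, U x & (mu U < +oo)%E].
Proof.
exists [set y | dist X x y < 1]; split; first exact: open_dist_lt.
  by rewrite /= (dist_eq0 hd x x).2.
have mB : measurable ([set y : X | dist X x y < 1] : set (borel X)).
  apply: open_borel; exact: open_dist_lt.
have mK : measurable ([set y | dist X x y <= 1] : set (borel X)).
  rewrite -[X in measurable X]setCK; apply: measurableC; apply: open_borel.
  rewrite (_ : ~` _ = [set y | 1 < dist X x y]); first exact: open_dist_gt.
  by apply/seteqP; split=> y /=; rewrite ltNge => /negP.
apply: (@le_lt_trans _ _ (mu [set y | dist X x y <= 1])); last first.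
  have hc : compact [set y : X | dist X x y <= 1] by exact: hp.
  exact: (radon_compact hr hc).
apply: le_measure; rewrite ?inE//.
by move=> y /= /ltW.
Qed.

(** If k > k' at one point, then k > k' on a product U x V of nonempty open sets with V of finite
    measure. The operators are tested on the indicator of V. At a point of U where the two values
    agree, the positive function k - k' has integral 0 over V, so V is null, against full support;
    hence U lies in the exceptional null set, again against full support. *)
Lemma kernel_op_le (k k' : X -> X -> R) :
  continuous (fun z : X * X => k z.1 z.2) ->
  continuous (fun z : X * X => k' z.1 z.2) ->
  (forall x, mu.-integrable setT (fun y : borel X => (k x y)%:E)) ->
  (forall x, mu.-integrable setT (fun y : borel X => (k' x y)%:E)) ->
  (forall f, L2 f -> (exists M : R, forall x, `|f x| <= M) ->
    ae_on setT (fun x => mmd_integral (fun y => k x y * f y) =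
                         mmd_integral (fun y => k' x y * f y))) ->
  forall x y, k x y <= k' x y.
Proof.
move=> ck ck' ik ik' kk' x0 y0; rewrite leNgt; apply/negP => lt0.
have : nbhs (x0, y0) [set z : X * X | 0 < k z.1 z.2 - k' z.1 z.2].
  have c : (k z.1 z.2 - k' z.1 z.2) @[z --> (x0, y0)] --> k x0 y0 - k' x0 y0.
    by apply: cvgB; [exact: (ck (x0, y0))|exact: (ck' (x0, y0))].
  by apply: (cvgr_gt _ c); rewrite subr_gt0.
move=> [[A B]] /= [Ax By] AB.
have [W [oW Wy Woo]] := finite_measure_nbhs y0.
pose V := B^° `&` W; pose U := A^°.
have oV : open V by apply: openI => //; exact: open_interior.
have oU : open U by exact: open_interior.
have mV : measurable (V : set (borel X)) by exact: open_borel.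
have mU : measurable (U : set (borel X)) by exact: open_borel.
have Voo : (mu V < +oo)%E.
  apply: le_lt_trans Woo; apply: le_measure; rewrite ?inE//; first exact: open_borel.
  by move=> y [].
have kpos x y : U x -> V y -> 0 < k x y - k' x y.
  move=> /interior_subset Ux [/interior_subset Vy _].
  by have := AB (x, y); apply.
have := hs oU; rewrite ltNge => /(_ _)/negP; apply.
  by exists x0.
pose f : X -> R := \1_V.
have mf : measurable_fun setT (f : borel X -> R) by exact: measurable_indic.
have fL : L2 f.
  apply/L2P; split => //.
  have -> : (\int[mu]_(x in [set: borel X]) (f x ^+ 2)%:E =
      \int[mu]_(x in [set: borel X]) (\1_V x)%:E)%E.
    apply: eq_integral => x _; congr EFin; rewrite /f indicE.
    by case: (_ \in _); rewrite ?expr1n ?expr0n.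
  by rewrite integral_indic// setIT.
have fb : exists M : R, forall x, `|f x| <= M.
  by exists 1 => x; rewrite /f indicE; case: (_ \in _); rewrite ?normr1 ?normr0.
have kf (j : X -> X -> R) x : mu.-integrable setT (fun y : borel X => (j x y)%:E) ->
    mu.-integrable setT (fun y : borel X => (j x y * f y)%:E).
  move=> ij; have /integrableP[mj _] := ij; apply: le_integrable ij => //.
    apply/measurable_EFinP; apply: measurable_funM => //; exact/measurable_EFinP.
  move=> y _ /=; rewrite lee_fin normrM ler_piMr// /f indicE.
  by case: (_ \in _); rewrite ?normr1 ?normr0.
have [N [mN N0 NP]] := kk' f fL fb.
rewrite -N0; apply: le_measure; rewrite ?inE// => x Ux; apply: NP => /= /(_ I) E.
have : mu V = 0%E.
  have I0 : (\int[mu]_(y in [set: borel X]) `|((k x y - k' x y) * f y)%:E| = 0)%E.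
    have -> : (\int[mu]_(y in [set: borel X]) `|((k x y - k' x y) * f y)%:E| =
      \int[mu]_(y in [set: borel X]) (k x y * f y - k' x y * f y)%:E)%E.
      apply: eq_integral => y _; rewrite -mulrBl /= ger0_norm// /f indicE.
      case: (boolP (y \in V)) => [/[!inE] yV|_]; rewrite ?mulr0// mulr1.
      exact/ltW/kpos.
    have ikk : mu.-integrable setT (fun y : borel X => (k x y * f y - k' x y * f y)%:E).
      under eq_fun do rewrite EFinB.
      by apply: integrableB => //; apply: kf.
    rewrite -[LHS]fineK ?integrable_fin_num//.
    congr EFin; rewrite -/(Rintegral _ _ _) RintegralB//; try exact: kf.
    by apply/eqP; rewrite subr_eq0; apply/eqP.
  have mkk : measurable_fun [set: borel X] (fun y : borel X => ((k x y - k' x y) * f y)%:E).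
    apply/measurable_EFinP; apply: measurable_funM => //.
    by apply: measurable_funB; apply/measurable_EFinP;
      [case/integrableP: (ik x)|case/integrableP: (ik' x)].
  have /ae_eq_integral_abs H := I0.
  have [M [mM M0 MP]] := H measurableT mkk.
  apply/eqP; rewrite -measure_le0 -M0; apply: le_measure; rewrite ?inE//.
  move=> y Vy; apply: MP => /= /(_ I) /eqP; rewrite eqe mulf_eq0 => /orP[|].
    by rewrite gt_eqF// kpos.
  by rewrite /f indicE mem_set// oner_eq0.
have := hs oV; rewrite lt0e => /(_ _)/andP[|/eqP].
  by exists y0; split => //; exact: By.
by [].
Qed.

End kernel_eq.

Section heat_kernel_theory.
Context {R : realType} (X : mmd_data R).
Local Notation mu := (refm X).

Lemma heat_kernelP : (exists p, is_heat_kernel (X := X) p) ->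
  is_heat_kernel (@heat_kernel R X).
Proof. by move=> /cid[p hp]; exact: (xgetI _ hp). Qed.

Variable p : R -> X -> X -> R.
Hypothesis hp : is_heat_kernel p.

Lemma heat_kernel_slice_continuous (t : R) : 0 < t ->
  continuous (fun z : X * X => p t z.1 z.2).
Proof.
move=> t0 z.
apply: (@continuous_comp _ _ _ (fun z : X * X => (t, z.1, z.2))
  (fun u : R * X * X => p u.1.1 u.1.2 u.2)).
  apply: (@cvg_pair _ _ _ (nbhs z) (nbhs (t, z.1)) (nbhs z.2)); last exact: cvg_snd.
  apply: (@cvg_pair _ _ _ (nbhs z) (nbhs t) (nbhs z.1)); last exact: cvg_fst.
  exact: cvg_cst.
exact: (heat_kernel_continuous hp).
Qed.

Lemma heat_kernel_measurable (t : R) (x : X) : 0 < t ->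
  measurable_fun setT (p t x : borel X -> R).
Proof.
move=> t0; apply: continuous_measurable_real => y.
apply: (@continuous_comp _ _ _ (fun z : X => (x, z)) (fun z : X * X => p t z.1 z.2)).
  by apply: cvg_pair; [exact: cvg_cst|exact: cvg_id].
exact: heat_kernel_slice_continuous.
Qed.

Lemma heat_kernel_integrable (t : R) (x : X) : 0 < t ->
  mu.-integrable setT (fun y : borel X => (p t x y)%:E).
Proof.
move=> t0; apply/integrableP; split.
  by apply/measurable_EFinP; exact: heat_kernel_measurable.
have -> : (\int[mu]_(y in [set: borel X]) `|(p t x y)%:E| =
    \int[mu]_(y in [set: borel X]) (p t x y)%:E)%E.
  apply: eq_integral => y _; rewrite gee0_abs// lee_fin ltW//.
  exact: (heat_kernel_gt0 hp).
by rewrite (heat_kernel_mass hp)// ltry.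
Qed.

Lemma heat_kernel_mass_real (t : R) (x : X) : 0 < t ->
  mmd_integral (fun y => p t x y) = 1.
Proof. by move=> t0; rewrite /mmd_integral /Rintegral (heat_kernel_mass hp). Qed.

End heat_kernel_theory.

(** * Transport of the heat kernel and of the Nash entropies *)

Section similarity_heat_kernel.
Context {R : realType} (X Y : mmd_data R) (phi : X -> Y) (psi : Y -> X)
  (b k : {posnum R}) (N : R).
Hypothesis sim : similarity phi psi b k.
Hypotheses (hX : is_mmd X N) (hY : is_mmd Y N).

Let lam := k%:num / b%:num.
Let lam0 : 0 < lam. Proof. by rewrite divr_gt0. Qed.
Let pX := @heat_kernel R X.
Let pY := @heat_kernel R Y.
Let hpX : is_heat_kernel pX. Proof. exact/heat_kernelP/(mmd_heat_kernel hX). Qed.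
Let hpY : is_heat_kernel pY. Proof. exact/heat_kernelP/(mmd_heat_kernel hY). Qed.
Let b0 : b%:num != 0. Proof. by []. Qed.

Lemma simV_L2 (f : X -> R) : L2 f -> L2 (f \o psi).
Proof.
move=> /L2P[mf foo].
have mfp : measurable_fun setT (f \o psi : borel Y -> R).
  apply: (@measurableT_comp _ _ _ (borel Y) (borel X) R f setT psi) => //.
  exact: simV_measurable sim.
apply/L2P; split => //; move: foo.
have -> : (\int[refm X]_(x in [set: borel X]) (f x ^+ 2)%:E =
   \int[refm X]_(x in [set: borel X]) ((1 * (f \o psi) (phi x)) ^+ 2)%:E)%E.
  by apply: eq_integral => x _ /=; rewrite (simK sim) mul1r.
rewrite (sim_L2_integral sim)// expr1n mul1r.
have : (0 <= \int[refm Y]_(y in [set: borel Y]) ((f \o psi) y ^+ 2)%:E)%E.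
  by apply: integral_ge0 => y _; rewrite lee_fin sqr_ge0.
case: (\int[_]_(_ in _) _)%E => [r _ _| |//]; first by rewrite ltry.
by rewrite gt0_muley// lte_fin.
Qed.

(** The kernel [k'] represents the transported flow f -> P_(lam t) (f \o psi) \o phi, its factor 1 /
    b compensating the change of measure. Uniqueness of the flow identifies the two operators almost
    everywhere, and [kernel_op_le], used in both directions, identifies the kernels everywhere. *)
Lemma sim_heat_kernel (t : R) (x y : X) : 0 < t ->
  pY (lam * t) (phi x) (phi y) = b%:num * pX t x y.
Proof.
move=> t0; have lt0 : 0 < lam * t by rewrite mulr_gt0.
pose k' (x y : X) := b%:num^-1 * pY (lam * t) (phi x) (phi y).
suff E : pX t x y = k' x y by rewrite E /k' mulrA divff// mul1r.
have ck : continuous (fun z : X * X => pX t z.1 z.2).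
  exact: heat_kernel_slice_continuous hpX _ t0.
have ck' : continuous (fun z : X * X => k' z.1 z.2).
  move=> z; apply: cvgMr.
  apply: (@continuous_comp _ _ _ (fun z : X * X => (phi z.1, phi z.2))
    (fun z : Y * Y => pY (lam * t) z.1 z.2)).
    apply: cvg_pair.
      by apply: (@continuous_comp _ _ _ (fun z : X * X => z.1) phi);
        [exact: cvg_fst|exact: (sim_continuous sim)].
    by apply: (@continuous_comp _ _ _ (fun z : X * X => z.2) phi);
        [exact: cvg_snd|exact: (sim_continuous sim)].
  exact: heat_kernel_slice_continuous hpY _ lt0 _.
have ik u := heat_kernel_integrable hpX u t0.
have ik' u : (refm X).-integrable setT (fun y : borel X => (k' u y)%:E).
  under eq_fun do rewrite EFinM.
  apply: integrableZl => //.
  apply: (sim_integrable sim (f := fun y => pY (lam * t) (phi u) y)).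
    exact: heat_kernel_measurable.
  exact: heat_kernel_integrable.
have kk f : L2 f -> (exists M : R, forall x, `|f x| <= M) ->
    ae_on setT (fun x => mmd_integral (fun y => pX t x y * f y) =
                         mmd_integral (fun y => k' x y * f y)).
  move=> fL fb; have fpL := simV_L2 fL.
  have flX := heat_kernel_flow hpX fL fb.
  have flY : is_heat_flow (f \o psi) (fun t => kernel_op pY t (f \o psi)).
    apply: (heat_kernel_flow hpY fpL).
    by case: fb => M fM; exists M => y'; exact: fM.
  have := sim_heat_flow sim (mmd_form hY) fpL flY.
  have -> : (f \o psi) \o phi = f.
    by apply/funext => z /=; rewrite (simK sim).
  move=> flYX; have := heat_flow_unique (mmd_form hX) fL flX flYX t0.
  rewrite /ae_on; apply: filterS => z + _ => /(_ I); rewrite {1}/kernel_op => ->.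
  rewrite /kernel_op -/lam.
  have mf : measurable_fun setT (f \o psi : borel Y -> R) by exact: L2_measurable fpL.
  have mpf : measurable_fun setT (fun y : borel Y => pY (lam * t) (phi z) y * (f \o psi) y).
    by apply: measurable_funM => //; exact: heat_kernel_measurable.
  have H := sim_integral sim mpf.
  (* As f is bounded by M, the product is dominated by M times the kernel, which has finite mass. *)
  have ip : (refm X).-integrable setT (fun y : borel X => (pY (lam * t) (phi z) (phi y) * f y)%:E).
    have [M fM] := fb.
    have ip0 : (refm X).-integrable setT (fun y : borel X => (M * (pY (lam * t) (phi z) (phi y)))%:E).
      under eq_fun do rewrite EFinM.
      apply: integrableZl => //.
      apply: (sim_integrable sim (f := fun y => pY (lam * t) (phi z) y)).
        exact: heat_kernel_measurable.
      exact: heat_kernel_integrable.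
    apply: le_integrable ip0 => //.
      apply/measurable_EFinP; apply: measurable_funM; last exact: L2_measurable fL.
      apply: (sim_measurable_comp sim (f := pY (lam * t) (phi z))).
      exact: heat_kernel_measurable.
    move=> y' _ /=; rewrite lee_fin !normrM mulrC.
    by rewrite ler_wpM2r// (le_trans (fM _))// ler_norm.
  apply: (mulfI b0); rewrite -H /mmd_integral -RintegralZl//.
    apply: eq_Rintegral => y' _ /=.
    by rewrite (simK sim) /k' -!mulrA mulVKf.
  rewrite (_ : EFin \o _ = (fun y => (b%:num^-1)%:E * (pY (lam * t) (phi z) (phi y) * f y)%:E)%E).
    exact: integrableZl.
  by apply/funext => y' /=; rewrite /k' -EFinM mulrA.
apply/eqP; rewrite eq_le; apply/andP; split.
  exact: (kernel_op_le (mmd_metric hX) (mmd_proper hX) (mmd_radon hX)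
    (mmd_full_support hX) ck ck' ik ik' kk).
apply: (kernel_op_le (mmd_metric hX) (mmd_proper hX) (mmd_radon hX)
    (mmd_full_support hX) ck' ck ik' ik) => f fL fb.
by have := kk f fL fb; rewrite /ae_on; apply: filterS => z zE zT; rewrite zE.
Qed.

Let pXpos (t : R) x y : 0 < t -> 0 < pX t x y.
Proof. exact: (heat_kernel_gt0 hpX). Qed.

(** The factor b of the kernel adds ln b to its logarithm, which integrates to ln b because the
    kernel has mass 1. The time change only affects the normalizing logarithm. *)
Lemma sim_nash (t : R) (x : X) : 0 < t ->
  nash N (lam * t) (phi x) = nash N t x - ln b%:num - N / 2 * ln lam.
Proof.
move=> t0; have lt0 : 0 < lam * t by rewrite mulr_gt0.
rewrite /nash.
have -> : ln (4 * pi * (lam * t)) = ln lam + ln (4 * pi * t).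
  have p0 : 0 < 4 * pi * t :> R by rewrite !mulr_gt0// pi_gt0.
  have -> : 4 * pi * (lam * t) = lam * (4 * pi * t) by rewrite mulrCA.
  by apply: lnM; rewrite posrE.
have mg : measurable_fun setT (fun y : borel Y =>
    pY (lam * t) (phi x) y * ln (pY (lam * t) (phi x) y)).
  by have /integrableP[/measurable_EFinP] := mmd_nash_finite hY (phi x) lt0.
have := sim_integral sim mg.
have -> : mmd_integral ((fun y : borel Y =>
      pY (lam * t) (phi x) y * ln (pY (lam * t) (phi x) y)) \o phi) =
   b%:num * (ln b%:num + mmd_integral (fun y => pX t x y * ln (pX t x y))).
  (* The constant ln b becomes an integral against the kernel, so that both sides are single
     integrals over X. *)
  rewrite -[ln _]mulr1 -(heat_kernel_mass_real hpX x t0).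
  have i1 := heat_kernel_integrable hpX x t0.
  have i2 := mmd_nash_finite hX x t0.
  have i1' : (refm X).-integrable setT (EFin \o (fun y : borel X => ln b%:num * pX t x y)).
    rewrite (_ : _ \o _ = fun y => ((ln b%:num)%:E * (pX t x y)%:E)%E)//.
    exact: integrableZl.
  rewrite /mmd_integral -RintegralZl// -RintegralD// -RintegralZl//;
    last exact: (integrableD measurableT i1' i2).
  apply: eq_Rintegral => y _ /=.
  by rewrite sim_heat_kernel// lnM ?posrE//; [ring|exact: pXpos].
move=> /(mulfI b0) <-; by rewrite /pX; field.
Qed.

Lemma sim_heat_nash (t s : R) (x : X) : 0 < t -> 0 < s ->
  heat_nash N (phi x) (lam * t) (lam * s) =
  heat_nash N x t s - ln b%:num - N / 2 * ln lam.
Proof.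
move=> t0 s0; have lt0 : 0 < lam * t by rewrite mulr_gt0.
have ls0 : 0 < lam * s by rewrite mulr_gt0.
have mg : measurable_fun setT (fun y : borel Y => pY (lam * s) (phi x) y * nash N (lam * t) y).
  by have /integrableP[/measurable_EFinP] := mmd_nash_integrable hY (phi x) lt0 ls0.
have := sim_integral sim mg.
have i1 := heat_kernel_integrable hpX x s0.
have i2 := mmd_nash_integrable hX x t0 s0.
set C := - ln b%:num - N / 2 * ln lam.
have i1' : (refm X).-integrable setT (EFin \o (fun y : borel X => C * pX s x y)).
  rewrite (_ : _ \o _ = fun y => (C%:E * (pX s x y)%:E)%E)//.
  exact: integrableZl.
have -> : mmd_integral ((fun y : borel Y => pY (lam * s) (phi x) y * nash N (lam * t) y) \o phi) =
   b%:num * (C + heat_nash N x t s).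
  rewrite -[C]mulr1 -(heat_kernel_mass_real hpX x s0).
  rewrite /heat_nash /kernel_op /mmd_integral -RintegralZl// -RintegralD// -RintegralZl//;
    last exact: (integrableD measurableT i1' i2).
  apply: eq_Rintegral => y _ /=.
  by rewrite sim_heat_kernel// sim_nash// /C /pX; ring.
move=> /(mulfI b0) H; transitivity (C + heat_nash N x t s); first exact: esym H.
by rewrite /C; ring.
Qed.

End similarity_heat_kernel.

(** * Concavity along inverse-time geodesics and limits *)

Section concavity.
Context {R : realType}.
Implicit Types (F : R -> R -> R) (gamma : R -> R * R).

Lemma concave_alongP F gamma : concave_along F gamma <->
  forall u x y : R, u \in `[0, 1] -> x \in `[0, 1] -> y \in `[0, 1] ->
    u * F (gamma x).1 (gamma x).2 + (1 - u) * F (gamma y).1 (gamma y).2 <=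
    F (gamma (u * x + (1 - u) * y)).1 (gamma (u * x + (1 - u) * y)).2.
Proof.
split=> [H u x y|H t x y].
  rewrite !in_itv/= => /andP[u0 u1] /andP[x0 x1] /andP[y0 y1].
  have := H (Itv01 u0 u1) x y; rewrite !inE/= !in_itv/= x0 x1 y0 y1 => /(_ isT isT).
  rewrite !convRE /=.
    by rewrite /unstable.onem !mulrN -opprD lerN2.
rewrite !inE/= => xI yI.
have tI : t%:num \in `[0, 1] by rewrite in_itv/= ge0 le1.
have := H t%:num x y tI xI yI.
rewrite !convRE /=.
by rewrite /unstable.onem !mulrN -opprD lerN2.
Qed.

(** Each concavity inequality involves three points of the curve, so pointwise convergence along the
    curve is enough. *)
Lemma concave_along_cvg (F_ : nat -> R -> R -> R) F gamma :
  (\forall n \near \oo, concave_along (F_ n) gamma) ->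
  (forall x : R, x \in `[0, 1] ->
    F_ n (gamma x).1 (gamma x).2 @[n --> \oo] --> F (gamma x).1 (gamma x).2) ->
  concave_along F gamma.
Proof.
move=> cF cv; apply/concave_alongP => u x y uI xI yI.
have zI : u * x + (1 - u) * y \in `[0, 1].
  move: uI xI yI; rewrite !in_itv/= => /andP[u0 u1] /andP[x0 x1] /andP[y0 y1].
  by apply/andP; split; nra.
have cl : (u * F_ n (gamma x).1 (gamma x).2 + (1 - u) * F_ n (gamma y).1 (gamma y).2)
  @[n --> \oo] --> u * F (gamma x).1 (gamma x).2 + (1 - u) * F (gamma y).1 (gamma y).2.
  by apply: cvgD; apply: cvgMr; exact: cv.
apply: ler_cvg_to cl (cv _ zI) _.
by apply: filterS cF => n /concave_alongP; apply.
Qed.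

End concavity.

Section rescale_similarity.
Context {R : realType} (X : mmd_data R) (a c : {posnum R}).

(** The old measure is 1 / c times the new one and the old form a^2 / c times the new one; the time
    factor is the quotient a^2. *)
Lemma rescale_similarity :
  @similarity R X (rescale a c X) id id
    (c%:num^-1)%:pos (a%:num ^+ 2 / c%:num)%:pos.
Proof.
split => //=.
- by move=> x; exact: cvg_id.
- by move=> x; exact: cvg_id.
- by move=> A mA; rewrite /mscale/= muleA -EFinM mulVf// mul1e.
- by move=> f g _ _; rewrite mulrA mulrA divfK// mulfV ?mul1r//.
Qed.

(** What matters about [C] is that it is the same for all poles and times, so that it does not
    affect concavity. *)
Lemma heat_nash_rescale (N : R) : is_mmd X N -> is_mmd (rescale a c X) N ->
  exists C : R, forall (x : X) (t s : R), 0 < t -> 0 < s ->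
    heat_nash (X := rescale a c X) N x t s =
    heat_nash N x (t / a%:num ^+ 2) (s / a%:num ^+ 2) + C.
Proof.
move=> hX hXac.
exists (- ln (c%:num^-1) - N / 2 * ln (a%:num ^+ 2)) => x t s t0 s0.
have a0 : 0 < a%:num ^+ 2 by rewrite exprn_gt0.
have ta : 0 < t / a%:num ^+ 2 by rewrite divr_gt0.
have sa : 0 < s / a%:num ^+ 2 by rewrite divr_gt0.
have := sim_heat_nash rescale_similarity hX hXac x ta sa.
have -> : (a%:num ^+ 2 / c%:num)%:pos%:num / (c%:num^-1)%:pos%:num = a%:num ^+ 2.
  by rewrite /=; field.
rewrite ![a%:num ^+ 2 * _]mulrC !divfK ?gt_eqF// => ->.
by rewrite /= addrA.
Qed.

Lemma rescale_concave (N q : R) (x : X) (gamma : R -> R * R) :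
  is_mmd X N -> is_mmd (rescale a c X) N ->
  inverse_time_geodesic gamma ->
  concave_along (fun t s => heat_nash N x t s + q / 2 * ln t)
    (fun u => ((gamma u).1 / a%:num ^+ 2, (gamma u).2 / a%:num ^+ 2)) ->
  concave_along (fun t s => heat_nash (X := rescale a c X) N x t s + q / 2 * ln t) gamma.
Proof.
move=> hX hXac hg /concave_alongP H.
have [C HC] := heat_nash_rescale hX hXac.
have E (u : R) : u \in `[0, 1] ->
  heat_nash (X := rescale a c X) N x (gamma u).1 (gamma u).2 + q / 2 * ln (gamma u).1 =
  heat_nash N x ((gamma u).1 / a%:num ^+ 2) ((gamma u).2 / a%:num ^+ 2) +
    q / 2 * ln ((gamma u).1 / a%:num ^+ 2) + (C + q / 2 * ln (a%:num ^+ 2)).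
  move=> /hg[t0 s0 _ _]; rewrite HC// ln_div ?posrE ?exprn_gt0//.
  by ring.
apply/concave_alongP => u y z uI yI zI.
have wI : u * y + (1 - u) * z \in `[0, 1].
  move: uI yI zI; rewrite !in_itv/= => /andP[u0 u1] /andP[x0 x1] /andP[y0 y1].
  by apply/andP; split; nra.
have := H u y z uI yI zI; rewrite /= !E//; lra.
Qed.

End rescale_similarity.

Section geodesic.
Context {R : realType}.

Lemma inverse_time_geodesic_scale (gamma : R -> R * R) (l : R) : 0 < l ->
  inverse_time_geodesic gamma ->
  inverse_time_geodesic (fun u => ((gamma u).1 / l, (gamma u).2 / l)).
Proof.
move=> l0 hg u uI; have [t0 s0 ts ti] := hg u uI; split=> /=.
- by rewrite divr_gt0.
- by rewrite divr_gt0.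
- by rewrite -!mulrDl ts.
- by rewrite !invfM ti; ring.
Qed.

Lemma inverse_time_geodesic_min_gt0 (gamma : R -> R * R) :
  inverse_time_geodesic gamma -> 0 < Num.min (gamma 0).1 (gamma 1).1.
Proof.
move=> hg; have [|t0 _ _ _] := hg 0; first by rewrite in_itv/= lexx ler01.
have [|t1 _ _ _] := hg 1; first by rewrite in_itv/= lexx ler01.
by rewrite lt_min t0 t1.
Qed.

(** 1 / t is a convex combination of its values at the ends, hence at most their maximum. *)
Lemma inverse_time_geodesic_ge (gamma : R -> R * R) : inverse_time_geodesic gamma ->
  forall u : R, u \in `[0, 1] -> Num.min (gamma 0).1 (gamma 1).1 <= (gamma u).1.
Proof.
move=> hg u uI; have [t0 _ _ ti] := hg u uI.
have := inverse_time_geodesic_min_gt0 hg.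
set m := Num.min _ _ => m0; have := m0; rewrite lt_min => /andP[a0 b0].
rewrite -lef_pV2 ?posrE// ti.
have ma : (gamma 0).1^-1 <= m^-1 by rewrite lef_pV2 ?posrE// ge_min lexx.
have mb : (gamma 1).1^-1 <= m^-1 by rewrite lef_pV2 ?posrE// ge_min lexx orbT.
move: uI; rewrite in_itv/= => /andP[u0 u1]; nra.
Qed.

End geodesic.

(** * Passage of the comparison to pointed limits *)

Section pmGH.
Context {R : realType}.

(** Entropies converge along convergent poles, so every point of the limit has to be reached by some
    sequence. [pmGH_ball] gives points that depend on the error; a choice independent of the error
    is needed. *)
Lemma pmGH_pole (X_ : nat -> mmd_data R) (x_ : forall n, X_ n)
    (X : mmd_data R) (x : X) (Z : metricType R)
    (i_ : forall n, X_ n -> Z) (i : X -> Z) :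
  pmGH_realization x_ x i_ i -> forall z : X,
  exists z_ : forall n, X_ n, i_ n (z_ n) @[n --> \oo] --> i z.
Proof.
move=> H z.
(* [z_n] almost realizes the distance from [i z] to the image of [X_ n]. *)
pose E n : set R := [set mdist (i z) (i_ n y) | y in [set: X_ n]].
have hE n : has_inf (E n).
  split; first by exists (mdist (i z) (i_ n (x_ n))), (x_ n).
  by exists 0 => _ [y _ <-]; exact: mdist_ge0.
have zP n : exists y : X_ n, mdist (i z) (i_ n y) < inf (E n) + n.+1%:R^-1.
  have n0 : 0 < n.+1%:R^-1 :> R by rewrite invr_gt0.
  have [_ [y _ <-] yE] := inf_adherent n0 (hE n).
  by exists y; exact: yE.
exists (fun n => sval (cid (zP n))).
apply/cvg_ballP => e e0.
have e2 : 0 < e / 2 by rewrite divr_gt0.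
have r0 : 0 < dist X x z + 1.
  have : 0 <= dist X x z by rewrite -(pmGH_isometry H) mdist_ge0.
  lra.
have N1 := pmGH_ball H r0 e2.
have N2 : \forall n \near \oo, n.+1%:R^-1 < e / 2.
  exact: near_infty_natSinv_lt (PosNum e2).
apply: filterS2 N1 N2 => n N1 N2.
have [y yE] : exists y : X_ n, mdist (i z) (i_ n y) < e / 2 by apply: N1; lra.
rewrite ballEmdist /=; case: (cid _) => w /= wE.
have : inf (E n) <= mdist (i z) (i_ n y).
  by apply: ge_inf; [case: (hE n)|exists y].
by move: (inf _) (n.+1%:R^-1) (mdist _ _) (mdist _ _) wE N2 yE => *; lra.
Qed.

(** The eventual concavity is required at all poles x simultaneously, because the pole approximating
    a given limit point changes with n. The rank may depend on the geodesic. *)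
Lemma entropy_heat_cvg_forward (N q : R) (X : mmd_data R)
    (a_ c_ : nat -> {posnum R}) (x_ : nat -> X) (Xoo : mmd_data R) (xoo : Xoo) :
  is_mmd X N ->
  entropy_heat_cvg N (fun i => rescale (a_ i) (c_ i) X) x_ Xoo xoo ->
  (forall gamma : R -> R * R, inverse_time_geodesic gamma ->
    (forall u : R, u \in `[0, 1] -> forward_region (gamma u)) ->
    \forall n \near \oo, forall x : X,
      concave_along (fun t s => heat_nash N x t s + q / 2 * ln t)
      (fun u => ((gamma u).1 / (a_ n)%:num ^+ 2, (gamma u).2 / (a_ n)%:num ^+ 2))) ->
  forward_comparison N q Xoo.
Proof.
move=> hX [hX_ [hXoo [Z [i_ [i [hr hz]]]]]] hc z gamma hg hf.
have [z_ zc] := pmGH_pole hr z.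
have [_ hn] := hz z_ z zc.
apply: (@concave_along_cvg R (fun n t s =>
  heat_nash (X := rescale (a_ n) (c_ n) X) N (z_ n) t s + q / 2 * ln t)).
  apply: filterS (hc gamma hg hf) => n H.
  exact: rescale_concave.
move=> u uI; apply: cvgD; last exact: cvg_cst.
have [t0 s0 _ _] := hg u uI.
(* Locally uniform convergence is used on a singleton, where it is pointwise convergence. *)
have := hn [set gamma u] (@compact_set1 _ _).
rewrite uniform_set1; apply=> //.
by move=> _ ->.
Qed.

End pmGH.

(** * Tangents at infinity and the logarithmic case *)

Section tangent.
Context {R : realType}.

Lemma HSCod_tangent (X : mmd_data R) (sigma N q : R)
    (a_ c_ : nat -> {posnum R}) (x_ : nat -> X) (Xoo : mmd_data R) (xoo : Xoo) :
  0 < q -> is_mmd X N -> HSCod sigma N q X ->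
  (a_ i)%:num @[i --> \oo] --> (0 : R) ->
  entropy_heat_cvg N (fun i => rescale (a_ i) (c_ i) X) x_ Xoo xoo ->
  forward_comparison N q Xoo.
Proof.
move=> q0 hX [_ _ /(_ q0)[S S0 hS]] a0 hc.
apply: entropy_heat_cvg_forward hX hc _ => gamma hg hf.
pose m := Num.min (gamma 0).1 (gamma 1).1.
have m0 : 0 < m by exact: inverse_time_geodesic_min_gt0.
(* The dilated curve has first coordinate at least m / a^2, which exceeds S once S a^2 < m. *)
have : \forall n \near \oo, S * ((a_ n)%:num * (a_ n)%:num) < m.
  have c0 : S * ((a_ n)%:num * (a_ n)%:num) @[n --> \oo] --> S * (0 * 0).
    by apply: cvgMr; exact: cvgM.
  by apply: (cvgr_lt _ c0); rewrite !mulr0.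
apply: filterS => n nm x; apply: hS.
  by apply: inverse_time_geodesic_scale => //; rewrite exprn_gt0.
move=> u uI; have [t0 s0 ts] := hf u uI; split=> /=; last first.
  by rewrite ler_pM2r// invr_gt0 exprn_gt0.
rewrite ler_pdivlMr ?exprn_gt0// expr2 (le_trans (ltW nm))//.
exact: inverse_time_geodesic_ge.
Qed.

(** The region t <= s is a cone, so it contains the dilations of its geodesics by every scale. *)
Lemma forward_comparison_tangent (X : mmd_data R) (N q : R)
    (a_ c_ : nat -> {posnum R}) (x_ : nat -> X) (Xoo : mmd_data R) (xoo : Xoo) :
  is_mmd X N -> forward_comparison N q X ->
  entropy_heat_cvg N (fun i => rescale (a_ i) (c_ i) X) x_ Xoo xoo ->
  forward_comparison N q Xoo.
Proof.
move=> hX hf hc; apply: entropy_heat_cvg_forward hX hc _ => gamma hg hr.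
apply: nearW => n x; apply: hf.
  by apply: inverse_time_geodesic_scale => //; rewrite exprn_gt0.
move=> u uI; have [t0 s0 ts] := hr u uI.
have a0 : 0 < (a_ n)%:num ^+ 2 by rewrite exprn_gt0.
by split=> /=; rewrite ?divr_gt0// ler_pM2r// invr_gt0.
Qed.

Lemma forward_comparison_log (X : mmd_data R) (x : X) (N q k C : R) :
  (forall t s : R, 0 < t -> 0 < s -> heat_nash N x t s = C + k * ln t) ->
  forward_comparison N q X -> k + q / 2 <= 0.
Proof.
move=> hE hf.
(* The inverse-time geodesic from t = 1 to t = 2 has midpoint t = 4/3, and
   (4/3)^2 < 2 = 1 * 2. *)
pose tt (u : R) : R := (1 - u / 2)^-1.
(* The constant sum 4 is twice the largest value of t, which keeps t <= s. *)
pose gamma (u : R) : R * R := (tt u, 4 - tt u).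
have ttI (u : R) : u \in `[0, 1] -> 1 <= tt u /\ tt u <= 2.
  rewrite in_itv/= => /andP[u0 u1]; rewrite /tt; split.
    by rewrite invf_ge1; lra.
  by rewrite invf_ple ?posrE; lra.
have hg : inverse_time_geodesic gamma.
  move=> u uI; have [t1 t2] := ttI u uI; rewrite /gamma/=; split; try lra.
  rewrite /tt !invrK; lra.
have H1 : forall u : R, u \in `[0, 1] -> forward_region (gamma u).
  by move=> u /ttI[t1 t2]; split => /=; lra.
have i0 : (0 : R) \in `[0, 1] by rewrite in_itv/= lexx ler01.
have i1 : (1 : R) \in `[0, 1] by rewrite in_itv/= lexx ler01.
have ih : (1 / 2 : R) \in `[0, 1] by rewrite in_itv/=; apply/andP; split; lra.
have /concave_alongP /(_ _ _ _ ih i0 i1) /= := hf x gamma hg H1.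
have -> : 1 / 2 * 0 + (1 - 1 / 2) * 1 = 1 / 2 :> R by lra.
have -> : tt 0 = 1 by rewrite /tt mul0r subr0 invr1.
have -> : tt 1 = 2 by rewrite /tt; field.
have -> : tt (1/2) = 4 / 3 by rewrite /tt; field.
rewrite !hE; try lra.
rewrite ln1 mulr0 mulr0.
have l2 : ln (4 / 3) + ln (4 / 3) < ln 2 :> R.
  rewrite -lnM ?posrE; [|lra|lra].
  by rewrite ltr_ln ?posrE; lra.
(* [H] amounts to (k + q / 2) (2 ln (4 / 3) - ln 2) >= 0, where the second factor is negative. *)
move=> H; rewrite leNgt; apply/negP => k0.
nra.
Qed.

End tangent.

(** * Lebesgue measure on boxes and homotheties *)

Section box.
Context {R : realType}.

Definition box m (lo hi : 'rV[R]_m) : set 'rV[R]_m :=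
  [set v | forall j, v ord0 j \in `](lo ord0 j), (hi ord0 j)[].

Lemma open_box m (lo hi : 'rV[R]_m) : open (box lo hi).
Proof.
rewrite openE => v bv; rewrite /interior.
have H (j : 'I_m) : \forall w \near (v : 'rV[R]_m),
    (w : 'rV[R]_m) ord0 j \in `](lo ord0 j), (hi ord0 j)[.
  have c : (w : 'rV[R]_m) ord0 j @[w --> (v : 'rV[R]_m)] --> v ord0 j.
    exact: (@coord_continuous R 1 m ord0 j v).
  apply: (c [set x | x \in `](lo ord0 j), (hi ord0 j)[]).
  have := @interval_open R (BRight (lo ord0 j)) (BLeft (hi ord0 j)).
  by move=> /(_ isT isT); rewrite openE => /(_ _ (bv j)).
exact: (@filter_forall _ _ (fun j (w : 'rV[R]_m) =>
  w ord0 j \in `](lo ord0 j), (hi ord0 j)[) (nbhs v) _ H).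
Qed.

Lemma box_measurable m (lo hi : 'rV[R]_m) :
  measurable (box lo hi : set (borel 'rV[R]_m)).
Proof. apply: sub_sigma_algebra; exact: open_box. Qed.

Definition boxes m : set (set 'rV[R]_m) := [set A | exists lo hi, A = box lo hi].

(** The boxes with rational corners inside U are enumerated by [unpickle]; indices that give no such
    box yield [set0], which is not a box in dimension 0. *)
Lemma open_bigcup_box m (U : set 'rV[R]_m) : open U ->
  exists F : nat -> set 'rV[R]_m, (forall n, F n = set0 \/ boxes (F n)) /\
    U = \bigcup_n F n.
Proof.
move=> oU.
pose bx (ab : 'rV[rat]_m * 'rV[rat]_m) : set 'rV[R]_m :=
  box (map_mx ratr ab.1) (map_mx ratr ab.2).
pose F n := if unpickle n is Some ab then
   if `[< bx ab `<=` U >] then bx ab else set0 else set0.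
exists F; split=> [n|].
  rewrite /F; case: unpickle => [ab|]; last by left.
  case: asboolP => _; last by left.
  by right; eexists; eexists; reflexivity.
apply/seteqP; split=> [v /= Uv|v [n _]]; last first.
  by rewrite /F; case: unpickle => // ab; case: asboolP => // abU /abU.
have /nbhs_ballP[e /= e0 eU] : nbhs (v : 'rV[R]_m) U.
  exact: open_nbhs_nbhs.
have lo j : {q : rat | ratr q \in `](v ord0 j - e), (v ord0 j)[}.
  by apply/cid/rat_in_itvoo; rewrite ltrBlDr ltrDl.
have hi j : {q : rat | ratr q \in `](v ord0 j), (v ord0 j + e)[}.
  by apply/cid/rat_in_itvoo; rewrite ltrDl.
pose ab := (\row_j sval (lo j), \row_j sval (hi j)).
exists (pickle ab) => //; rewrite /F pickleK.
have abU : bx ab `<=` U.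
  move=> w /= bw; apply: eU; split => // i j; rewrite (ord1 i).
  move: (bw j) (svalP (lo j)) (svalP (hi j)).
  rewrite /= !mxE !in_itv/= /ball /= ltr_norml.
  by move=> /andP[w1 w2] /andP[a1 a2] /andP[b1 b2]; apply/andP; split; lra.
case: asboolP => // _ j.
move: (svalP (lo j)) (svalP (hi j)); rewrite !mxE !in_itv/=.
by move=> /andP[_ ->] /andP[->].
Qed.

Lemma box_generate m :
  @measurable _ (borel 'rV[R]_m) = <<s @boxes m >>.
Proof.
apply/seteqP; split.
  apply: smallest_sub; first exact: smallest_sigma_algebra.
  move=> U /open_bigcup_box[F [F0 ->]].
  have [_ _ sU] := smallest_sigma_algebra setT (@boxes m).
  apply: sU => n; have [->|FB] := F0 n.
    by have [] := smallest_sigma_algebra setT (@boxes m).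
  exact: sub_sigma_algebra.
apply: smallest_sub; first exact: smallest_sigma_algebra.
by move=> _ [lo [hi ->]]; exact: box_measurable.
Qed.

Lemma boxI m (lo hi lo' hi' : 'rV[R]_m) :
  box lo hi `&` box lo' hi' =
  box (\row_j Num.max (lo ord0 j) (lo' ord0 j))
      (\row_j Num.min (hi ord0 j) (hi' ord0 j)).
Proof.
apply/seteqP; split=> v /=.
  move=> [H H'] j; move: (H j) (H' j); rewrite !in_itv/= !mxE.
  by rewrite gt_max lt_min => /andP[-> ->] /andP[-> ->].
move=> H; split=> j; have := H j; rewrite !in_itv/= !mxE gt_max lt_min.
  by move=> /andP[/andP[-> _] /andP[-> _]].
by move=> /andP[/andP[_ ->] /andP[_ ->]].
Qed.

Definition cube m (n : nat) : set 'rV[R]_m :=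
  box (const_mx (- n%:R)) (const_mx n%:R).

Lemma bigcup_cube m : \bigcup_n @cube m n = setT.
Proof.
apply/seteqP; split=> // v _.
exists (Num.bound (\sum_j `|v ord0 j|)) => // j.
rewrite !mxE in_itv/= -ltr_norml.
apply: le_lt_trans (archi_boundP _); last by apply: sumr_ge0 => i _.
by rewrite (bigD1 j)//= lerDl sumr_ge0.
Qed.

(** Boxes are stable under intersection and generate the Borel sets, and the cubes exhaust the space
    with finite measure. *)
Lemma box_measure_unique m (m1 m2 : {measure set (borel 'rV[R]_m) -> \bar R}) :
  (forall lo hi, m1 (box lo hi) = m2 (box lo hi)) ->
  (forall n, (m1 (@cube m n) < +oo)%E) ->
  forall A, measurable A -> m1 A = m2 A.
Proof.
move=> m12 m1oo A mA.
apply: (@measure_unique _ R (borel 'rV[R]_m) (@boxes m) (@cube m)) => //.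
- exact: box_generate.
- by move=> _ _ [l [h ->]] [l' [h' ->]]; rewrite boxI; eexists; eexists; reflexivity.
- by move=> n; eexists; eexists; reflexivity.
- exact: bigcup_cube.
- by move=> _ [l [h ->]].
Qed.

(** Sides are truncated at 0 because a box with a reversed side is empty; without this, two reversed
    sides would give a positive product. *)
Lemma lebesgue_rV_box m (lo hi : 'rV[R]_m) :
  lebesgue_rV m (box lo hi) =
  (\prod_j Num.max (hi ord0 j - lo ord0 j) 0)%:E.
Proof.
elim: m lo hi => [|m IH] lo hi.
  rewrite big_ord0 /= diracE mem_set//.
  by move=> [].
pose tl (v : 'rV[R]_m.+1) : 'rV[R]_m := \row_j v ord0 (lift ord0 j).
rewrite /= /cons_measure /pushforward.
have -> : @cons_rV R m @^-1` (box lo hi) =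
    `](lo ord0 ord0), (hi ord0 ord0)[%classic `*` box (tl lo) (tl hi).
  apply/seteqP; split=> -[x v] /=.
    move=> H; split=> [|j] /=.
      by have := H ord0; rewrite mxE unlift_none.
    by have := H (lift ord0 j); rewrite !mxE liftK.
  move=> [/= Hx Hv] j; rewrite mxE /=.
  case: (unliftP ord0 j) => [k ->|->] //.
  by have := Hv k; rewrite !mxE.
rewrite product_measure1E//; last exact: box_measurable.
rewrite IH big_ord_recl EFinM; congr (_ * _)%E.
  apply: (eq_trans (lebesgue_measure_itv `](lo ord0 ord0), (hi ord0 ord0)[)).
  rewrite /= lte_fin; case: ifPn => [lt|].
    by rewrite max_l// subr_ge0 ltW.
  by rewrite -leNgt => le; rewrite max_r// subr_le0.
by congr EFin; apply: eq_bigr => j _; rewrite !mxE.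
Qed.

Definition homothety m (a : R) (w v : 'rV[R]_m) : 'rV[R]_m := a *: v + w.

Lemma homothety_continuous m a w : continuous (@homothety m a w).
Proof.
move=> v A /nbhs_ballP[e /= e0 eA]; apply/nbhs_ballP.
have a1 : 0 < `|a| + 1 by rewrite ltr_wpDl.
exists (e / (`|a| + 1)); first by rewrite /= divr_gt0.
move=> u [_ vu]; apply: eA; split => // i j; have := vu i j.
rewrite /ball /= !mxE opprD addrACA subrr addr0 -mulrBr normrM.
rewrite ltr_pdivlMr// mulrC; apply: le_lt_trans.
by rewrite ler_wpM2r// lerDl.
Qed.

Lemma homothetyK m (a : R) (w : 'rV[R]_m) : a != 0 ->
  cancel (homothety a w) (homothety a^-1 (- (a^-1 *: w))).
Proof.
by move=> a0 v; rewrite /homothety scalerDr scalerA mulVf// scale1r addrK.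
Qed.

Lemma homothetyVK m (a : R) (w : 'rV[R]_m) : a != 0 ->
  cancel (homothety a^-1 (- (a^-1 *: w))) (homothety a w).
Proof.
by move=> a0 v; rewrite /homothety scalerBr !scalerA divff// !scale1r subrK.
Qed.

Lemma homothety_box m (a : R) (w lo hi : 'rV[R]_m) : 0 < a ->
  homothety a w @^-1` box lo hi =
  box (a^-1 *: (lo - w)) (a^-1 *: (hi - w)).
Proof.
move=> a0; apply/seteqP; split=> v /= H j; have := H j; rewrite !in_itv/= !mxE;
  rewrite ![a^-1 * _]mulrC ltr_pdivrMr// ltr_pdivlMr// ltrBlDr ltrBrDr;
  by rewrite ![_ * a]mulrC.
Qed.

(** The preimage of a box is a box with sides divided by a, so the two measures agree on boxes. *)
Lemma lebesgue_rV_homothety m (a : {posnum R}) (w : 'rV[R]_m) (A : set (borel 'rV[R]_m)) :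
  measurable A ->
  lebesgue_rV m (homothety a%:num w @^-1` A) =
  (((a%:num ^+ m)^-1)%:E * lebesgue_rV m A)%E.
Proof.
move=> mA.
have mh : measurable_fun setT (homothety a%:num w : borel 'rV[R]_m -> borel 'rV[R]_m).
  apply: (@continuous_measurable_borel 'rV[R]_m 'rV[R]_m).
  exact: homothety_continuous.
have bp : 0 < (a%:num ^+ m)^-1 by rewrite invr_gt0 exprn_gt0.
pose b : {posnum R} := PosNum bp.
have E lo hi : lebesgue_rV m (homothety a%:num w @^-1` box lo hi) =
    (b%:num%:E * lebesgue_rV m (box lo hi))%E.
  rewrite homothety_box// !lebesgue_rV_box.
  rewrite -EFinM; congr EFin.
  rewrite /= -exprVn -[X in a%:num^-1 ^+ X](card_ord m) -prodr_const -big_split/=.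
  apply: eq_bigr => j _; rewrite !mxE -mulrBr opprB addrA subrK.
  by rewrite maxr_pMr ?mulr0// ltW.
have : pushforward (lebesgue_rV m) (homothety a%:num w : borel 'rV[R]_m -> borel 'rV[R]_m) A =
    mscale b%:num%:nng (lebesgue_rV m) A.
  apply: box_measure_unique => [lo hi|n|//]; first exact: E.
  have := E (const_mx (- n%:R)) (const_mx n%:R).
  by rewrite lebesgue_rV_box -EFinM /cube /= /pushforward => ->; rewrite ltry.
exact.
Qed.

End box.

(** * Bump functions and the fundamental lemma *)

Section smooth.
Context {R : realType}.
Implicit Types (f g : R -> R) (k : nat).

(** The derivative is a witness rather than ['D_1 f], so that the sum, product and chain rules
    supply it directly. *)
Fixpoint Ck1 k f : Prop :=
  if k is k'.+1 then
    exists2 f' : R -> R, (forall x : R, is_derive x (1 : R) f (f' x)) & Ck1 k' f'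
  else continuous f.

Lemma is_derive_continuous f f' : (forall x : R, is_derive x (1 : R) f (f' x)) -> continuous f.
Proof.
move=> df x; apply/differentiable_continuous/derivable1_diffP.
by have [] := df x.
Qed.

Lemma Ck1_continuous k f : Ck1 k f -> continuous f.
Proof. by case: k => // k [f' df _]; exact: is_derive_continuous df. Qed.

Lemma Ck1W k f : Ck1 k.+1 f -> Ck1 k f.
Proof.
elim: k f => [|k IH] f; first exact: Ck1_continuous.
by move=> [f' df f'k]; exists f' => //; exact: IH.
Qed.

Lemma Ck1_cst k (c : R) : Ck1 k (cst c).
Proof.
elim: k c => [|k IH] c; first by move=> x; exact: cst_continuous.
by exists (cst 0) => // x; exact: is_derive_cst.
Qed.

Lemma Ck1D k f g : Ck1 k f -> Ck1 k g -> Ck1 k (f + g).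
Proof.
elim: k f g => [|k IH] f g; first by move=> cf cg x; apply: cvgD; [exact: cf|exact: cg].
by move=> [f' df f'k] [g' dg g'k]; exists (f' + g'); [move=> x; exact: is_deriveD|exact: IH].
Qed.

Lemma Ck1M k f g : Ck1 k f -> Ck1 k g -> Ck1 k (f * g).
Proof.
elim: k f g => [|k IH] f g; first by move=> cf cg x; apply: cvgM; [exact: cf|exact: cg].
move=> fk gk; have fk' := Ck1W fk; have gk' := Ck1W gk.
move: fk gk => [f' df f'k] [g' dg g'k]; exists (f * g' + g * f').
  by move=> x; exact: is_deriveM.
by apply: Ck1D; exact: IH.
Qed.

Lemma Ck1_affine k f (a b : R) : Ck1 k f -> Ck1 k (fun x => f (a * x + b)).
Proof.
elim: k f => [|k IH] f.
  move=> cf x; apply: (@continuous_comp _ _ _ (fun x => a * x + b) f); last exact: cf.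
  by apply: cvgD; [apply: cvgM; [exact: cvg_cst|exact: cvg_id]|exact: cvg_cst].
move=> [f' df f'k]; exists ((fun x => f' (a * x + b)) * cst a).
  move=> x.
  have d1 : is_derive (a * x + b) (1 : R) f (f' (a * x + b)) by exact: df.
  have d2 : is_derive x (1 : R) (fun x => a * x + b) a.
    have -> : (fun x => a * x + b) = (cst a * id + cst b) by apply/funext.
    apply: is_derive_eq; rewrite /= scaler0 !addr0.
    by rewrite [_ *: _]mulr1.
  exact: (@is_derive1_comp _ f (fun x => a * x + b) x _ _ d1 d2).
by apply: Ck1M; [exact: IH|exact: Ck1_cst].
Qed.

Definition smooth f := forall k, Ck1 k f.

Lemma smooth_is_derive f : smooth f -> forall x : R, is_derive x (1 : R) f ('D_1 f x).
Proof. by move=> /(_ 1%N)[f' df _] x; apply/derivableP; have [] := df x. Qed.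

Lemma smooth_derive f : smooth f -> smooth (fun x => 'D_1 f x).
Proof.
move=> sf k; have [f' df f'k] := sf k.+1.
suff -> : (fun x => 'D_1 f x) = f' by [].
by apply/funext => x; rewrite derive_val.
Qed.

End smooth.

Section flat.
Context {R : realType}.
Implicit Types (p : {poly R}) (c s : R).

(** The factor p (1 / s) makes this family of functions, p (1 / s) e^(- c / s) extended by 0, stable
    under differentiation. *)
Definition flat p c s : R := if 0 < s then p.[s^-1] * expR (- (c / s)) else 0.

Lemma expRN_le s c : 0 < c -> 0 < s -> expR (- (c / s)) <= s / c.
Proof.
move=> c0 s0; have cs : 0 < c / s by rewrite divr_gt0.
rewrite expRN -[s / c]invrK invf_div lef_pV2 ?posrE ?expR_gt0//.
by apply: le_trans (expR_ge1Dx _); rewrite lerDr.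
Qed.

(** Induction on p: each new factor 1 / s is absorbed by half of the exponential, since e^(- c / (2
    s)) / s <= 2 / c. Hence c must vary in the induction. *)
Lemma flat_bound p c : 0 < c -> exists2 K : R, 0 <= K &
  forall s, `|flat p c s| <= K * `|s|.
Proof.
elim/poly_ind: p c => [|p r IH] c c0.
  by exists 0 => // s; rewrite /flat horner0 mul0r if_same normr0 mul0r.
have c2 : 0 < c / 2 by rewrite divr_gt0.
have [K K0 HK] := IH _ c2.
exists (K * (2 / c) + `|r| / c).
  by rewrite addr_ge0// ?mulr_ge0 ?divr_ge0 ?invr_ge0// ltW.
move=> s; have := HK s; rewrite /flat; case: ifP => s0; last first.
  by rewrite normr0 => _; rewrite mulr_ge0// addr_ge0// ?mulr_ge0 ?divr_ge0 ?invr_ge0// ltW.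
rewrite (gtr0_norm s0) => H.
rewrite hornerMXaddC mulrDl (le_trans (ler_normD _ _))// [leRHS]mulrDl lerD//.
  have -> : p.[s^-1] * s^-1 * expR (- (c / s)) =
     (p.[s^-1] * expR (- (c / 2 / s))) * (s^-1 * expR (- (c / 2 / s))).
    have -> : expR (- (c / s)) = expR (- (c / 2 / s)) * expR (- (c / 2 / s)).
      rewrite -expRD; congr expR; field.
      by rewrite gt_eqF.
    by ring.
  rewrite normrM [leRHS]mulrAC; apply: ler_pM => //.
  rewrite ger0_norm; last by rewrite mulr_ge0 ?expR_ge0// invr_ge0 ltW.
  have sV : 0 <= s^-1 by rewrite invr_ge0 ltW.
  apply: (le_trans (ler_wpM2l sV (expRN_le c2 s0))).
  by rewrite mulKf ?gt_eqF// invf_div.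
rewrite normrM -mulrA ler_wpM2l// ger0_norm ?expR_ge0// [leRHS]mulrC.
exact: expRN_le.
Qed.

(** In the variable y = 1 / s, d/ds is - y^2 d/dy, and it is applied to p (y) e^(- c y). *)
Definition flat_deriv p c := 'X ^+ 2 * (c%:P * p - p^`()).

Lemma flat_is_derive p c : 0 < c ->
  forall s : R, is_derive s 1 (flat p c) (flat (flat_deriv p c) c s).
Proof.
move=> c0 s; have [s0|s0|s0] := ltgtP s 0.
- rewrite {2}/flat ltNge (ltW s0)/=.
  have d0 : is_derive s (1 : R) (cst (0 : R)) 0 by exact: is_derive_cst.
  apply: near_eq_is_derive d0.
  have : \forall x \near s, x < 0 by exact: lt_nbhsl.
  by apply: filterS => x x0; rewrite /flat ltNge (ltW x0).
- have sn0 : s != 0 by rewrite gt_eqF.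
  have dV : is_derive s (1:R) (fun y : R => y^-1) (- s ^- 2).
    have := @is_deriveV R id s 1 1 sn0 (is_derive_id _ _).
    by rewrite [_ *: _]mulr1.
  have d1 : is_derive s (1:R) (horner p \o (fun y => y^-1)) (p^`().[s^-1] * (- s ^- 2)).
    exact: is_derive1_comp.
  have d2 : is_derive s (1:R) (expR \o ((cst (- c)) * (fun y => y^-1))) 
     (expR (- c * s^-1) * (c * s ^- 2)).
    apply: is_derive1_comp.
    apply: is_derive_eq; rewrite /= scaler0 addr0.
    by rewrite [_ *: _]mulrNN.
  have := is_deriveM d1 d2.
  set l := (X in is_derive _ _ _ X).
  have -> : l = flat (flat_deriv p c) c s.
    rewrite /l /flat s0 /flat_deriv /= !hornerE /=.
    rewrite -[_ *: _ + _]/(_ * _ + _ * _) mulNr.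
    have -> : (cst (- c) * (fun y : R => y^-1)) s = - (c / s) by rewrite -mulNr.
    by rewrite -!exprVn; ring.
  apply: near_eq_is_derive.
  have : \forall x \near s, 0 < x by exact: lt_nbhsr.
  by apply: filterS => x x0; rewrite /flat x0 /= mulNr.
- rewrite s0 {2}/flat ltxx.
  (* At 0 the difference quotient of [flat p c] is itself the flat function of p * X, so it is
     bounded by K |h|. *)
  have [K K0 HK] := flat_bound (p * 'X) c0.
  have cv : h^-1 *: (flat p c (h *: 1 + 0) - flat p c 0) @[h --> (0:R)^'] --> (0:R).
    apply/cvgrPdist_le => e e0.
    have : \forall h \near (0:R)^', `|h| <= e / (K + 1).
      by apply: dnbhs0_le; rewrite divr_gt0// ltr_wpDl.
    apply: filterS => h hK; rewrite sub0r normrN.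
    rewrite {2}/flat ltxx subr0 addr0 [h *: 1]mulr1 [_ *: _]/(_ * _).
    apply: (@le_trans _ _ (K * `|h|)); last first.
      rewrite ler_pdivlMr ?ltr_wpDl// in hK; apply: le_trans hK.
      by rewrite mulrC ler_wpM2l// lerDl.
    apply: le_trans (HK h).
    have -> : flat (p * 'X) c h = h^-1 * flat p c h.
      by rewrite /flat; case: ifP => h0; [rewrite hornerMX; ring|rewrite mulr0].
    by [].
  apply: DeriveDef; first by apply/cvg_ex; exists 0; exact: cv.
  exact: (cvg_lim _ cv).
Qed.

Lemma flat_smooth p c : 0 < c -> smooth (flat p c).
Proof.
move=> c0 k; elim: k p => [|k IH] p.
  exact: is_derive_continuous (flat_is_derive p c0).
by exists (flat (flat_deriv p c) c) => //; exact: flat_is_derive.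
Qed.

(** As c decreases to 0 these functions tend to the indicator of the open interval. *)
Definition bump (c lo hi x : R) : R := flat 1 c (x - lo) * flat 1 c (hi - x).

Lemma flat1 c s : flat 1 c s = if 0 < s then expR (- (c / s)) else 0.
Proof. by rewrite /flat hornerE mul1r. Qed.

Lemma flat1_ge0 c s : 0 <= flat 1 c s.
Proof. by rewrite flat1; case: ifP => // _; exact: expR_ge0. Qed.

Lemma flat1_le1 c s : 0 < c -> flat 1 c s <= 1.
Proof.
move=> c0; rewrite flat1; case: ifP => // s0.
by rewrite expR_le1 oppr_le0 divr_ge0// ltW.
Qed.

Lemma bump_smooth c lo hi : 0 < c -> smooth (bump c lo hi).
Proof.
move=> c0 k.
have -> : bump c lo hi =
    (fun x => flat 1 c (1 * x + (- lo))) * (fun x => flat 1 c (-1 * x + hi)).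
  apply/funext => x; rewrite /bump.
  rewrite [RHS](_ : _ = flat 1 c (1 * x - lo) * flat 1 c (-1 * x + hi))//.
  by rewrite mul1r mulN1r [- x + hi]addrC.
by apply: Ck1M; apply: Ck1_affine; exact: flat_smooth.
Qed.

Lemma bump_ge0 c lo hi x : 0 <= bump c lo hi x.
Proof. by rewrite mulr_ge0// flat1_ge0. Qed.

Lemma bump_le1 c lo hi x : 0 < c -> bump c lo hi x <= 1.
Proof. by move=> c0; rewrite mulr_ile1 ?flat1_ge0 ?flat1_le1. Qed.

Lemma bump_out c lo hi x : x \notin `]lo, hi[ -> bump c lo hi x = 0.
Proof.
rewrite in_itv/= negb_and -!leNgt /bump !flat1 => /orP[H|H].
  by rewrite subr_gt0 ltNge H mul0r.
by rewrite [0 < hi - x]subr_gt0 [x < hi]ltNge H mulr0.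
Qed.

Lemma bump_cvg lo hi x : x \in `]lo, hi[ ->
  bump (n.+1%:R^-1) lo hi x @[n --> \oo] --> (1 : R).
Proof.
rewrite in_itv/= => /andP[lx xh].
have F s : 0 < s -> flat 1 (n.+1%:R^-1) s @[n --> \oo] --> (1 : R).
  move=> s0.
  have -> : (fun n => flat 1 (n.+1%:R^-1) s) = (fun n => expR (- (harmonic n / s))).
    by apply/funext => n; rewrite flat1 s0.
  rewrite -[X in _ --> X](@expR0 R).
  apply: (@cvg_comp _ _ _ (fun n => - (@harmonic R n / s)) expR _ (nbhs (0 : R))); last first.
    exact: continuous_expR.
  have -> : (0 : R) = - (0 / s) by rewrite mul0r oppr0.
  by apply: cvgN; apply: cvgM; [exact: cvg_harmonic|exact: cvg_cst].
rewrite -[X in _ --> X](mulr1 1); apply: cvgM; apply: F; rewrite subr_gt0//.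
Qed.

End flat.

Section test_functions.
Context {R : realType}.

Lemma continuous_big_prod (T : topologicalType) (I : Type) (s : seq I) (F : I -> T -> R) :
  (forall i, continuous (F i)) -> continuous (fun v => \prod_(i <- s) F i v).
Proof.
move=> cF; elim: s => [|i s IH] v.
  under eq_fun do rewrite big_nil.
  exact: cst_continuous.
under eq_fun do rewrite big_cons.
by apply: cvgM; [exact: cF|exact: IH].
Qed.

Lemma is_derive_cvg (V : normedModType R) (f : V -> R) (x v : V) (l : R) :
  h^-1 *: (f (h *: v + x) - f x) @[h --> (0:R)^'] --> l -> is_derive x v f l.
Proof.
move=> cv; apply: DeriveDef; first by apply/cvg_ex; exists l; exact: cv.
exact: (cvg_lim _ cv).
Qed.

Lemma cvg_is_derive (V : normedModType R) (f : V -> R) (x v : V) (l : R) :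
  is_derive x v f l -> h^-1 *: (f (h *: v + x) - f x) @[h --> (0:R)^'] --> l.
Proof. by move=> [df <-]; exact: df. Qed.

Lemma is_derive_prod m (g g' : 'I_m -> R -> R) (j : 'I_m) (v : 'rV[R]_m) :
  (forall x : R, is_derive x (1 : R) (g j) (g' j x)) ->
  is_derive v (delta_mx ord0 j) (fun v => \prod_i g i (v ord0 i))
    (\prod_i (if i == j then g' i else g i) (v ord0 i)).
Proof.
move=> dg; apply: is_derive_cvg.
pose P := \prod_(i | i != j) g i (v ord0 i).
have -> : \prod_i (if i == j then g' i else g i) (v ord0 i) = g' j (v ord0 j) * P.
  rewrite (bigD1 j)//= eqxx; congr (_ * _).
  by apply: eq_bigr => i ij; rewrite (negbTE ij).
have -> : (fun h : R => h^-1 *: (\prod_i g i ((h *: delta_mx ord0 j + v) ord0 i) -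
     \prod_i g i (v ord0 i))) =
   (fun h => (h^-1 *: (g j (h *: 1 + v ord0 j) - g j (v ord0 j))) * P).
  apply/funext => h; rewrite (bigD1 j)//= [X in _ - X](bigD1 j)//=.
  rewrite !mxE !eqxx.
  have -> : \prod_(i < m | i != j) g i ((h *: delta_mx ord0 j + v) ord0 i) = P.
    by apply: eq_bigr => i ij; rewrite !mxE (negbTE ij) andbF mulr0 add0r.
  rewrite -/P -mulrBl [h%:A]/(h * 1).
  by rewrite -[_ *: _]/(h^-1 * (_ * P)) mulrA.
apply: cvgM; last exact: cvg_cst.
by apply: cvg_is_derive; exact: dg.
Qed.

(** A partial derivative replaces one factor by its derivative and so gives a product of the same
    kind; the induction runs over all families g. *)
Lemma Ck_prod m k (g : 'I_m -> R -> R) : (forall j, smooth (g j)) ->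
  Ck k (fun v : 'rV[R]_m => \prod_j g j (v ord0 j)).
Proof.
have c (f : 'I_m -> R -> R) : (forall j, smooth (f j)) ->
    continuous (fun v : 'rV[R]_m => \prod_j f j (v ord0 j)).
  move=> sf; apply: continuous_big_prod => i v.
  apply: (@continuous_comp _ _ _ (fun v : 'rV[R]_m => v ord0 i) (f i)).
    exact: coord_continuous.
  exact: Ck1_continuous (sf i 0%N) _.
elim: k g => [|k IH] g sg; split; [exact: c|by []|exact: c|move=> j].
pose g' i x := 'D_1 (g i) x.
have dg v := is_derive_prod (g := g) (g' := g') v (smooth_is_derive (sg j)).
split; first by move=> v; have [] := dg v.
have -> : 'D_(delta_mx ord0 j) (fun v : 'rV[R]_m => \prod_i g i (v ord0 i)) =
  (fun v => \prod_i (if i == j then g' i else g i) (v ord0 i)).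
  by apply/funext => v; have [_] := dg v.
apply: (IH (fun i => if i == j then g' i else g i)) => i.
by case: eqP => // _; exact: smooth_derive.
Qed.

Definition box_bump m (lo hi : 'rV[R]_m) (n : nat) (v : 'rV[R]_m) : R :=
  \prod_j bump n.+1%:R^-1 (lo ord0 j) (hi ord0 j) (v ord0 j).

Lemma box_bump_out m (lo hi : 'rV[R]_m) n v : ~ box lo hi v -> box_bump lo hi n v = 0.
Proof.
move=> /existsNP[j /negP vj]; rewrite /box_bump (bigD1 j)//= bump_out ?mul0r//.
Qed.

Lemma box_bump_ge0 m (lo hi : 'rV[R]_m) n v : 0 <= box_bump lo hi n v.
Proof. by apply: prodr_ge0 => j _; exact: bump_ge0. Qed.

Lemma box_bump_le m (lo hi : 'rV[R]_m) n v : box_bump lo hi n v <= \1_(box lo hi) v.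
Proof.
rewrite indicE; case: (boolP (v \in _)) => [_|]; last first.
  by rewrite notin_setE => /(box_bump_out n) ->.
apply: (@le_trans _ _ (\prod_(j < m) (1 : R))); last by rewrite big1.
apply: ler_prod => j _; rewrite bump_ge0 bump_le1//.
Qed.

Lemma box_bump_cvg m (lo hi v : 'rV[R]_m) :
  box_bump lo hi n v @[n --> \oo] --> (\1_(box lo hi) v : R).
Proof.
rewrite indicE; case: (boolP (v \in _)) => [|]; last first.
  rewrite notin_setE => H; rewrite (_ : (fun _ => _) = cst 0); first exact: cvg_cst.
  by apply/funext => n; rewrite box_bump_out.
rewrite inE => vb; rewrite /box_bump.
have -> : (true%:R : R) = \prod_(j <- index_enum 'I_m) (1 : R) by rewrite big1.
elim: (index_enum _) => [|j s IH].
  by rewrite big_nil; under eq_fun do rewrite big_nil; exact: cvg_cst.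
rewrite big_cons; under eq_fun do rewrite big_cons.
by apply: cvgM; [exact: bump_cvg|exact: IH].
Qed.

Lemma box_bump_test m (lo hi : 'rV[R]_m) n : test_function (box_bump lo hi n).
Proof.
split=> [k|].
  apply: (@Ck_prod m k (fun j => bump n.+1%:R^-1 (lo ord0 j) (hi ord0 j))) => j.
  by apply: bump_smooth; rewrite invr_gt0.
exists [set v : 'rV[R]_m | forall j, `[lo ord0 j, hi ord0 j]%classic (v ord0 j)]; split.
  apply: (@rV_compact R m (fun j => `[lo ord0 j, hi ord0 j]%classic)) => j.
  exact: segment_compact.
move=> v H; apply: box_bump_out => vb; apply: H => j /=.
exact: subset_itv_oo_cc (vb j).
Qed.

End test_functions.

(** * The fundamental lemma for square-integrable functions *)

Section density.
Context d (T : measurableType d) (R : realType) (mu : {measure set T -> \bar R}).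
Variables (f : T -> \bar R) (mf : measurable_fun setT f) (f0 : forall x, (0 <= f x)%E).

(** The hypotheses are arguments, so that the measure structure can be inferred from the term
    itself. *)
Definition density of measurable_fun setT f & (forall x, (0 <= f x)%E) :=
  fun A : set T => (\int[mu]_(x in A) f x)%E.

Let density_set0 : density mf f0 set0 = 0%E.
Proof. by rewrite /density integral_set0. Qed.

Let density_ge0 A : (0 <= density mf f0 A)%E.
Proof. by apply: integral_ge0. Qed.

Let density_sigma_additive : semi_sigma_additive (density mf f0).
Proof. exact: semi_sigma_additive_nng_induced. Qed.

HB.instance Definition _ := isMeasure.Build _ _ _ (density mf f0)
  density_set0 density_ge0 density_sigma_additive.

End density.

Section fundamental_lemma.
Context {R : realType} (m : nat).
Local Notation leb := (@lebesgue_rV R m).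
Implicit Types (h : 'rV[R]_m -> R) (lo hi : 'rV[R]_m).

Lemma box_indic_L2 lo hi :
  (\1_(box lo hi) : borel 'rV[R]_m -> R) \in Lfun leb 2%:E.
Proof.
have mB := box_measurable lo hi; apply/L2P; split; first exact: measurable_indic.
have -> : (\int[leb]_v (((\1_(box lo hi) : 'rV[R]_m -> R) v) ^+ 2)%:E =
    \int[leb]_v ((\1_(box lo hi) : borel 'rV[R]_m -> R) v)%:E)%E.
  apply: eq_integral => v _; congr EFin; rewrite indicE.
  by case: (_ \in _); rewrite ?expr1n ?expr0n.
rewrite (@integral_indic _ (borel 'rV[R]_m) R leb setT measurableT _ mB) setIT.
apply: (@le_lt_trans _ _ (\prod_j Num.max (hi ord0 j - lo ord0 j) 0)%:E); last exact: ltry.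
by rewrite le_eqVlt; apply/orP; left; apply/eqP; exact: lebesgue_rV_box.
Qed.

Lemma box_bump_measurable lo hi n :
  measurable_fun setT (box_bump lo hi n : borel 'rV[R]_m -> R).
Proof.
apply: (@continuous_measurable_real R 'rV[R]_m).
by have [/(_ 0%N)[c _] _] := box_bump_test lo hi n; exact: c.
Qed.

Lemma L2_box_bump_le h lo hi n (v : 'rV[R]_m) :
  `|h v * box_bump lo hi n v| <= `|h v * \1_(box lo hi) v|.
Proof.
rewrite !normrM ler_wpM2l// ger0_norm ?box_bump_ge0//.
by rewrite (le_trans (box_bump_le _ _ _ _))// ler_norm.
Qed.

Lemma L2_box_bump_integrable h lo hi n :
  (h : borel 'rV[R]_m -> R) \in Lfun leb 2%:E ->
  leb.-integrable setT (fun v : borel 'rV[R]_m => (h v * box_bump lo hi n v)%:E).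
Proof.
move=> hL; apply: le_integrable (L2_mul_integrable hL (box_indic_L2 lo hi)) => //.
  apply/measurable_EFinP; apply: measurable_funM; first exact: L2_measurable hL.
  exact: box_bump_measurable.
by move=> v _ /=; rewrite lee_fin L2_box_bump_le.
Qed.

(** Dominated convergence: the bumps tend to the indicator of the box and stay below it. *)
Lemma L2_box_integral_eq0 h :
  (h : borel 'rV[R]_m -> R) \in Lfun leb 2%:E ->
  (forall lo hi n, \int[leb]_v (h v * box_bump lo hi n v) = 0) ->
  forall lo hi, (\int[leb]_(v in [set: borel 'rV[R]_m]) (h v * \1_(box lo hi) v)%:E = 0)%E.
Proof.
move=> hL h0 lo hi.
have ih := L2_mul_integrable hL (box_indic_L2 lo hi).
have mh := L2_measurable hL.
have cv : (\int[leb]_(v in [set: borel 'rV[R]_m]) (h v * box_bump lo hi n v)%:E @[n --> \oo] -->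
    \int[leb]_(v in [set: borel 'rV[R]_m]) (h v * \1_(box lo hi) v)%:E)%E.
  have ptw (v : 'rV[R]_m) : (h v * box_bump lo hi n v)%:E @[n --> \oo] -->
      (h v * \1_(box lo hi) v)%:E.
    apply: cvg_EFin; first exact: nearW.
    by apply: cvgM; [exact: cvg_cst|exact: box_bump_cvg].
  have mb n := measurable_int _ (L2_box_bump_integrable lo hi n hL).
  have ae1 : {ae leb, forall v : borel 'rV[R]_m, [set: borel 'rV[R]_m] v ->
      (h v * box_bump lo hi n v)%:E @[n --> \oo] --> (h v * \1_(box lo hi) v)%:E}.
    by apply: aeW => v _; exact: ptw.
  have ae2 : {ae leb, forall (v : borel 'rV[R]_m) n, [set: borel 'rV[R]_m] v ->
      (`|(h v * box_bump lo hi n v)%:E| <= `|(h v * \1_(box lo hi) v)%:E|)%E}.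
    by apply: aeW => v n _; rewrite lee_fin; exact: L2_box_bump_le.
  by have [] := dominated_convergence measurableT mb (measurable_int _ ih) ae1
    (integrable_abse ih) ae2.
have E : (fun n => \int[leb]_(v in [set: borel 'rV[R]_m]) (h v * box_bump lo hi n v)%:E)%E = cst 0%E.
  apply/funext => n; rewrite -[LHS]fineK.
    by rewrite -/(Rintegral _ _ _) h0.
  by apply: integrable_fin_num => //; exact: L2_box_bump_integrable.
apply/esym; apply: cvg_unique cv => //.
rewrite E; exact: cvg_cst.
Qed.

(** The positive and negative parts of h on a cube are densities of two finite measures which agree
    on boxes, hence everywhere; so the two parts agree almost everywhere. *)
Lemma L2_ae_eq0 h :
  (h : borel 'rV[R]_m -> R) \in Lfun leb 2%:E ->
  (forall lo hi n, \int[leb]_v (h v * box_bump lo hi n v) = 0) ->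
  {ae leb, forall v : borel 'rV[R]_m, h v = 0}.
Proof.
move=> hL h0.
have mh := L2_measurable hL.
(* A square-integrable function need not be integrable, but its restriction to a cube is. *)
suff H n : {ae leb, forall v : borel 'rV[R]_m, @cube R m n v -> h v = 0}.
  have := ae_foralln H; apply: filterS => v hv.
  have : [set: 'rV[R]_m] v by [].
  by rewrite -(@bigcup_cube R m) => -[n _]; exact: hv.
pose f (v : borel 'rV[R]_m) := (h v * \1_(@cube R m n) v)%:E.
have fi : leb.-integrable setT f.
  exact: L2_mul_integrable hL (box_indic_L2 _ _).
have mf := measurable_int _ fi.
have fp := integrable_funepos measurableT fi.
have fn := integrable_funeneg measurableT fi.
pose dp : {measure set (borel 'rV[R]_m) -> \bar R} :=
  density leb (measurable_funepos mf) (funepos_ge0 f).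
pose dn : {measure set (borel 'rV[R]_m) -> \bar R} :=
  density leb (measurable_funeneg mf) (funeneg_ge0 f).
have dpE A : dp A = (\int[leb]_(x in A) f^\+ x)%E by [].
have dnE A : dn A = (\int[leb]_(x in A) f^\- x)%E by [].
have dpn A : measurable A -> dp A = dn A.
  apply: (@box_measure_unique R m dp dn) => [lo hi|k].
  - have mB := box_measurable lo hi.
    have fpf : dp (box lo hi) \is a fin_num.
      by apply: integrable_fin_num => //; apply: integrableS fp.
    have fnf : dn (box lo hi) \is a fin_num.
      by apply: integrable_fin_num => //; apply: integrableS fn.
    have : (dp (box lo hi) - dn (box lo hi) = 0)%E.
      rewrite dpE dnE -integralE.
      rewrite integral_mkcond.
      (* A box meets the cube in a box, so the integral of f over it is an integral of h over a
         box. *)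
      have := L2_box_integral_eq0 hL h0
        (\row_j Num.max ((const_mx (- n%:R) : 'rV[R]_m) ord0 j) (lo ord0 j))
        (\row_j Num.min ((const_mx n%:R : 'rV[R]_m) ord0 j) (hi ord0 j)).
      rewrite -boxI => <-; apply: eq_integral => v _.
      rewrite patchE /f -/(@cube R m n) indicI /=.
      rewrite [in RHS]indicE [X in _ * (_ * X)]indicE.
      by case: (v \in box _ _); rewrite ?mulr1 ?mulr0.
    by move/eqP; rewrite sube_eq// ?add0e ?fin_num_adde_defl//; move/eqP.
  - rewrite -/(dp _) ltey_eq; apply/orP; left.
    apply: integrable_fin_num => //; first exact: box_measurable.
    by apply: integrableS fp => //; exact: box_measurable.
have := @integral_ae_eq _ _ _ leb setT measurableT f^\-%E f^\+%E fp
  (measurable_int _ fn) (fun A _ mA => dpn A mA).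
apply: filterS => v /(_ I) fE vn.
have : f v = 0%E.
  rewrite -[LHS]/(f v) (funeposneg f) /= fE subee//.
  by rewrite funenegE; case: (leP _ _) => // ?; rewrite ?ge0_fin_numE.
by rewrite /f indicE mem_set// mulr1 => -[].
Qed.

End fundamental_lemma.

(** * Euclidean spaces *)

Section Rintegral_scale.
Context d (T : measurableType d) (R : realType).
Variable mu : {measure set T -> \bar R}.

(* If [f] is not integrable, both integrals have the same junk value. *)
Lemma RintegralZ_gt0 (a : R) (f : T -> R) : 0 < a -> measurable_fun setT f ->
  \int[mu]_x (a * f x) = a * \int[mu]_x f x.
Proof.
move=> a0 mf; have mf' : measurable_fun setT (fun x => (f x)%:E) by exact/measurable_EFinP.
rewrite /Rintegral.
have -> : (\int[mu]_x (a * f x)%:E = \int[mu]_x (a%:E * (f x)%:E))%E by [].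
rewrite integralE [X in _ = _ * fine X]integralE ge0_funeposM ?ge0_funenegM ?ltW//.
rewrite !ge0_integralZl_EFin ?ltW//; last 2 first.
- exact: measurable_funeneg.
- exact: measurable_funepos.
set p := (\int[_]_(_ in _) _)%E; set n := (\int[_]_(_ in _) _)%E.
have : (0 <= n)%E by exact: integral_ge0.
have : (0 <= p)%E by exact: integral_ge0.
move: p n => [p| |] [n| |]//= _ _; rewrite ?gt0_muley ?lte_fin//= ?mulr0//.
by rewrite mulrBr.
Qed.

End Rintegral_scale.

(** * Weak derivatives and homotheties *)

Section weak_partial_unique.
Context {R : realType} (m : nat).
Local Notation leb := (@lebesgue_rV R m).
Implicit Types f g : 'rV[R]_m -> R.

Lemma is_weak_partial_unique (j : 'I_m) f g g' :
  is_weak_partial j f g -> is_weak_partial j f g' ->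
  {ae leb, forall v : borel 'rV[R]_m, g v = g' v}.
Proof.
move=> [gL gE] [g'L g'E].
have := @L2_ae_eq0 R m (fun v => (-1) * g' v + g v) (L2_lin (-1) g'L gL).
have H lo hi n : \int[leb]_v ((-1 * g' v + g v) * box_bump lo hi n v) = 0.
  have bt := box_bump_test lo hi n.
  have ig := L2_box_bump_integrable lo hi n gL.
  have ig' := L2_box_bump_integrable lo hi n g'L.
  have E := gE _ bt; have E' := g'E _ bt.
  transitivity (\int[leb]_v (g v * box_bump lo hi n v - g' v * box_bump lo hi n v)).
    by apply: eq_Rintegral => v _; ring.
  rewrite RintegralB//; apply/eqP; rewrite subr_eq0; apply/eqP.
  by apply: oppr_inj; rewrite -E -E'.
move=> /(_ H); apply: filterS => v; lra.
Qed.

Lemma weak_partialP (j : 'I_m) f : (exists g, is_weak_partial j f g) ->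
  is_weak_partial j f (weak_partial j f).
Proof. by move=> /cid[g fg]; exact: (xgetI _ fg). Qed.

End weak_partial_unique.

Section homothety_test.
Context {R : realType} (m : nat).
Implicit Types (f g phi : 'rV[R]_m -> R) (w : 'rV[R]_m).

Lemma homothety_is_derive (a : R) w phi (v e : 'rV[R]_m) (l : R) : 0 < a ->
  is_derive (homothety a w v) e phi l ->
  is_derive v e (phi \o homothety a w) (a * l).
Proof.
move=> a0 /cvg_is_derive cv; apply: is_derive_cvg.
have H : a * ((a * h)^-1 *: (phi ((a * h) *: e + homothety a w v) -
    phi (homothety a w v))) @[h --> (0:R)^'] --> a * l.
  by apply: cvgMr; exact: (cvg_comp _ _ (cvg_scale_dnbhs a0) cv).
apply: (cvg_eqfun _ H) => h /=.
have -> : homothety a w (h *: e + v) = (a * h) *: e + homothety a w v.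
  by rewrite /homothety scalerDr scalerA addrA.
(* The two quotients must agree at h = 0 as well, where both are 0. *)
have [->|h0] := eqVneq h 0; first by rewrite mulr0 !scale0r !add0r subrr !scaler0 mulr0.
rewrite -[_ *: _]/((a * h)^-1 * _) -[RHS]/(h^-1 * _) mulrA; congr (_ * _).
by rewrite invfM mulrA divff ?mul1r// gt_eqF.
Qed.

Lemma homothety_derivable (a : R) w phi (e : 'rV[R]_m) : 0 < a ->
  (forall v, derivable phi v e) ->
  (forall v, derivable (phi \o homothety a w) v e) /\
  'D_e (phi \o homothety a w) = (fun v => a * ('D_e phi (homothety a w v))).
Proof.
move=> a0 dphi.
have d v : is_derive v e (phi \o homothety a w) (a * ('D_e phi (homothety a w v))).
  by apply: homothety_is_derive => //; exact/derivableP.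
by split=> [v|]; [have [] := d v|apply/funext => v; have [] := d v].
Qed.

(** Each derivative of [phi \o homothety a w] produces a factor a, which the induction of
    [Ck_homothety] has to carry. *)
Lemma CkZ k (c : R) phi : Ck k phi -> Ck k (fun v => c * phi v).
Proof.
have cc (psi : 'rV[R]_m -> R) : continuous psi -> continuous (fun v => c * psi v).
  move=> cpsi v; apply: (@continuous_comp _ _ _ psi (fun x => c * x)).
    exact: cpsi.
  exact: mulrl_continuous.
elim: k phi => [|k IH] phi [cphi dphi]; split; [exact: cc|by []|exact: cc|].
move=> j; have [dj kj] := dphi j.
have d v : is_derive v (delta_mx ord0 j : 'rV[R]_m) (fun v => c * phi v)
    (c * 'D_(delta_mx ord0 j) phi v).
  have := is_deriveM (is_derive_cst c v (delta_mx ord0 j)) (derivableP (dj v)).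
  move=> /is_derive_eq; apply; rewrite scaler0 addr0.
  by [].
split; first by move=> v; have [] := d v.
rewrite (_ : 'D_ _ _ = (fun v => c * 'D_(delta_mx ord0 j) phi v)); first exact: IH.
by apply/funext => v; have [] := d v.
Qed.

Lemma Ck_homothety k (a : R) w phi : 0 < a -> Ck k phi -> Ck k (phi \o homothety a w).
Proof.
have cc (psi : 'rV[R]_m -> R) : continuous psi -> continuous (psi \o homothety a w).
  move=> cpsi v; apply: continuous_comp; first exact: homothety_continuous.
  exact: cpsi.
move=> a0; elim: k phi => [|k IH] phi [cphi dphi].
  by split=> //; exact: cc.
split; first exact: cc.
move=> j; have [dj kj] := dphi j.
have [h1 h2] := homothety_derivable w a0 dj; split => //.
by rewrite h2; exact: (CkZ a (IH _ kj)).
Qed.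

Lemma test_homothety (a : R) w phi : 0 < a -> test_function phi ->
  test_function (phi \o homothety a w).
Proof.
move=> a0 [kphi [K [cK K0]]]; split=> [k|]; first exact: Ck_homothety.
have an0 : a != 0 by rewrite gt_eqF.
exists (homothety a^-1 (- (a^-1 *: w)) @` K); split.
  apply: continuous_compact => //; apply: continuous_subspaceT.
  exact: homothety_continuous.
move=> v Hv; apply: K0 => Kv; apply: Hv; exists (homothety a w v) => //.
exact: homothetyK.
Qed.

Context (a : {posnum R}) (w : 'rV[R]_m).
Local Notation leb := (@lebesgue_rV R m).
Let T := homothety a%:num w.
Let S := homothety a%:num^-1 (- (a%:num^-1 *: w)).
Let an0 : a%:num != 0. Proof. by []. Qed.
Let TK : cancel T S. Proof. exact: homothetyK. Qed.
Let SK : cancel S T. Proof. exact: homothetyVK. Qed.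
Let bp : 0 < (a%:num ^+ m)^-1. Proof. by rewrite invr_gt0 exprn_gt0. Qed.
Let b : {posnum R} := PosNum bp.

Let mT : measurable_fun setT (T : borel 'rV[R]_m -> borel 'rV[R]_m).
Proof.
apply: (@continuous_measurable_borel 'rV[R]_m 'rV[R]_m).
exact: homothety_continuous.
Qed.

Let lebT (A : set (borel 'rV[R]_m)) : measurable A ->
  leb (T @^-1` A) = (b%:num%:E * leb A)%E.
Proof. exact: lebesgue_rV_homothety. Qed.

Lemma homothety_L2 f : (f : borel 'rV[R]_m -> R) \in Lfun leb 2%:E ->
  (f \o T : borel 'rV[R]_m -> R) \in Lfun leb 2%:E.
Proof. exact: L2_scaled mT lebT f. Qed.

(** A change of variables moves the homothety to the test function; the Jacobian b appears on both
    sides, and the factor a comes from the derivative of the test function. *)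
Lemma homothety_weak_partial (j : 'I_m) f g :
  (f : borel 'rV[R]_m -> R) \in Lfun leb 2%:E ->
  is_weak_partial j f g ->
  is_weak_partial j (f \o T) (fun v => a%:num * g (T v)).
Proof.
move=> fL [gL gE]; have mf := L2_measurable fL; have mg := L2_measurable gL; split.
  have -> : (fun v => a%:num * g (T v)) = (fun v => (a%:num - 1) * (g \o T) v + (g \o T) v).
    by apply/funext => v /=; ring.
  by apply: L2_lin; exact: homothety_L2.
move=> phi tphi.
have aV0 : 0 < a%:num^-1 by rewrite invr_gt0.
(* [psi] satisfies psi \o T = phi, so its derivative at [T v] is 1 / a times that of phi at v. *)
pose psi := phi \o S.
have tpsi : test_function psi by exact: test_homothety.
have [kpsi _] := tpsi; have [kphi _] := tphi.
have mpsi : measurable_fun setT (psi : borel 'rV[R]_m -> R).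
  apply: (@continuous_measurable_real R 'rV[R]_m).
  by have [c _] := kpsi 0%N; exact: c.
have mdpsi : measurable_fun setT ('D_(delta_mx ord0 j) psi : borel 'rV[R]_m -> R).
  apply: (@continuous_measurable_real R 'rV[R]_m).
  by have [_ /(_ j) [_ [c _]]] := kpsi 1%N; exact: c.
have dphi : forall v, derivable phi v (delta_mx ord0 j : 'rV[R]_m).
  by have [_ /(_ j) []] := kphi 1%N.
have dE : 'D_(delta_mx ord0 j) psi = (fun v => a%:num^-1 * 'D_(delta_mx ord0 j) phi (S v)).
  by have [] := homothety_derivable (- (a%:num^-1 *: w)) aV0 dphi.
have -> : \int[leb]_v ((f \o T) v * 'D_(delta_mx ord0 j) phi v) =
    \int[leb]_v ((fun u => a%:num * (f u * 'D_(delta_mx ord0 j) psi u)) (T v)).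
  have dEv u : 'D_(delta_mx ord0 j) psi (T u) = a%:num^-1 * 'D_(delta_mx ord0 j) phi u.
    transitivity (a%:num^-1 * 'D_(delta_mx ord0 j) phi (S (T u))); last by rewrite TK.
    exact: (congr1 (fun F => F (T u)) dE).
  apply: eq_Rintegral => v _ /=.
  transitivity (a%:num * (f (T v) * (a%:num^-1 * 'D_(delta_mx ord0 j) phi v))).
    by rewrite mulrCA mulVKf.
  by congr (_ * (_ * _)); exact: esym (dEv v).
have mfd : measurable_fun setT (fun u : borel 'rV[R]_m => f u * 'D_(delta_mx ord0 j) psi u).
  exact: measurable_funM.
rewrite (Rintegral_scaled mT lebT (f := fun u => a%:num * (f u * 'D_(delta_mx ord0 j) psi u)));
    last exact: measurable_funM.
rewrite RintegralZ_gt0// gE//.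
have -> : \int[leb]_v (a%:num * g (T v) * phi v) =
    \int[leb]_v ((fun u => a%:num * (g u * psi u)) (T v)).
  by apply: eq_Rintegral => v _ /=; rewrite /psi /= TK mulrA.
have mgp : measurable_fun setT (fun u : borel 'rV[R]_m => g u * psi u).
  exact: measurable_funM.
rewrite (Rintegral_scaled mT lebT (f := fun u => a%:num * (g u * psi u)));
    last exact: measurable_funM.
by rewrite RintegralZ_gt0// !mulrN.
Qed.

End homothety_test.

Section euclid_similarity.
Context {R : realType} (m : nat) (c : {posnum R}).
Local Notation leb := (@lebesgue_rV R m).
Local Notation E := (euclid m c).

Lemma dom_homothety (a : {posnum R}) (w : 'rV[R]_m) (f : 'rV[R]_m -> R) :
  dom E f -> dom E (f \o homothety a%:num w).
Proof.
move=> [fL fd]; split; first exact: homothety_L2.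
move=> j; have [g fg] := fd j; eexists; exact: homothety_weak_partial fg.
Qed.

(** The equality is only almost everywhere: [weak_partial] makes separate choices for f and for its
    composite. *)
Lemma weak_partial_homothety (a : {posnum R}) (w : 'rV[R]_m) (f : 'rV[R]_m -> R) (j : 'I_m) :
  dom E f ->
  {ae leb, forall v : borel 'rV[R]_m, weak_partial j (f \o homothety a%:num w) v =
     a%:num * weak_partial j f (homothety a%:num w v)}.
Proof.
move=> fD; have [fL fd] := fD; have [_ fTd] := dom_homothety a w fD.
apply: is_weak_partial_unique (weak_partialP (fTd j)) _.
exact: homothety_weak_partial (weak_partialP (fd j)).
Qed.

(** The measure contributes a^(-m) and the two gradients a^2, so k / b = a^2. *)
Lemma euclid_similarity (a b k : {posnum R}) (w : 'rV[R]_m) :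
  b%:num = (a%:num ^+ m)^-1 -> k%:num = a%:num ^+ 2 * b%:num ->
  @similarity R E E (homothety a%:num w) (homothety a%:num^-1 (- (a%:num^-1 *: w))) b k.
Proof.
move=> bE kE; have an0 : a%:num != 0 by [].
have aV0 : 0 < a%:num^-1 by rewrite invr_gt0.
have TK := homothetyK w an0; have SK := homothetyVK w an0.
have refmT (A : set (borel 'rV[R]_m)) : measurable A ->
    refm E (homothety a%:num w @^-1` A) = (b%:num%:E * refm E A)%E.
  move=> mA; rewrite /= /mscale/= lebesgue_rV_homothety// bE.
  by rewrite muleCA.
have mT : measurable_fun setT (homothety a%:num w : borel 'rV[R]_m -> borel 'rV[R]_m).
  apply: (@continuous_measurable_borel 'rV[R]_m 'rV[R]_m).
  exact: homothety_continuous.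
split => //.
- exact: homothety_continuous.
- exact: homothety_continuous.
- move=> f; split=> [|fD]; first exact: dom_homothety.
  have := dom_homothety (PosNum aV0) (- (a%:num^-1 *: w)) fD.
  by rewrite -compA (_ : _ \o _ = id)//; apply/funext => v /=; rewrite SK.
- move=> f g fD gD /=.
  pose F v := \sum_j weak_partial j f v * weak_partial j g v.
  have mwp (h : 'rV[R]_m -> R) : dom E h -> forall j,
      measurable_fun setT (weak_partial j h : borel 'rV[R]_m -> R).
    move=> [_ hd] j; have [hL _] := weak_partialP (hd j).
    exact: L2_measurable hL.
  have mS (h1 h2 : 'rV[R]_m -> R) : dom E h1 -> dom E h2 ->
      measurable_fun setT (fun v : borel 'rV[R]_m => \sum_j weak_partial j h1 v * weak_partial j h2 v).
    move=> h1D h2D; apply: measurable_sum => j.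
    by apply: measurable_funM; exact: mwp.
  have mF : measurable_fun setT (F : borel 'rV[R]_m -> R) by exact: mS.
  have aeE : {ae refm E, forall v : borel 'rV[R]_m,
     \sum_j weak_partial j (f \o homothety a%:num w) v * weak_partial j (g \o homothety a%:num w) v =
     a%:num ^+ 2 * F (homothety a%:num w v)}.
    have ae1 : {ae leb, forall v : borel 'rV[R]_m, forall j : 'I_m,
        weak_partial j (f \o homothety a%:num w) v = a%:num * weak_partial j f (homothety a%:num w v) /\
        weak_partial j (g \o homothety a%:num w) v = a%:num * weak_partial j g (homothety a%:num w v)}.
      apply: (@filter_forall _ _ (fun j (v : borel 'rV[R]_m) => _ /\ _)) => j.
      apply: filterS2 (weak_partial_homothety a w j fD) (weak_partial_homothety a w j gD).
      by move=> v; split.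
    (* A null set of the Lebesgue measure is null for its multiple [refm E]. *)
    have [N [mN N0 NP]] := ae1.
    exists N; split => //; first by rewrite /= /mscale/= N0 mule0.
    move=> v Hv; apply: NP => /= Hj; apply: Hv => /=.
    rewrite /F mulr_sumr; apply: eq_bigr => j _; have [-> ->] := Hj j; ring.
  transitivity (\int[refm E]_v (a%:num ^+ 2 * F (homothety a%:num w v))).
    congr fine; apply: ae_eq_integral => //.
    - by apply/measurable_EFinP; apply: mS; exact: dom_homothety.
    - apply/measurable_EFinP; apply: measurable_funM => //.
      exact: (measurableT_comp mF mT).
    - by apply: filterS aeE => v H _; congr EFin.
  rewrite (Rintegral_scaled mT refmT (f := fun v => a%:num ^+ 2 * F v));
    last exact: measurable_funM.
  by rewrite RintegralZ_gt0 ?exprn_gt0// kE mulrA [b%:num * _]mulrC.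
Qed.

(* The Gaussian kernel is never computed: homotheties rescale the Nash entropy,
   which determines it up to an additive constant. *)
Lemma euclid_nash (N : R) : is_mmd E N -> forall (t : R) (x : E), 0 < t ->
  nash N t x = nash N 1 ((0 : 'rV[R]_m) : E) + (m%:R - N) / 2 * ln t.
Proof.
move=> hE t x t0.
have a0 : 0 < Num.sqrt t by rewrite sqrtr_gt0.
pose a : {posnum R} := PosNum a0.
have b0 : 0 < (a%:num ^+ m)^-1 by rewrite invr_gt0 exprn_gt0.
pose b : {posnum R} := PosNum b0.
have k0 : 0 < a%:num ^+ 2 * b%:num by rewrite mulr_gt0// exprn_gt0.
pose k : {posnum R} := PosNum k0.
have aE : a%:num ^+ 2 = t by rewrite /= sqr_sqrtr// ltW.
(* With a = sqrt t the time factor is t, and the homothety v -> a v + x sends 0 to x. *)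
have sim := @euclid_similarity a b k x erefl erefl.
have := sim_nash sim hE hE ((0 : 'rV[R]_m) : E) (@ltr01 R).
have -> : k%:num / b%:num = t by rewrite /k [LHS]mulfK// aE.
have -> : homothety a%:num x 0 = x by rewrite /homothety scaler0 add0r.
rewrite mulr1 => ->.
have lna : ln a%:num = ln t / 2.
  by rewrite -aE lnXn// mulr2n; field.
have -> : ln b%:num = - (m%:R * (ln t / 2)).
  by rewrite /= lnV ?posrE ?exprn_gt0// lnXn// -[Num.sqrt t]/(a%:num) lna mulr_natl.
by field.
Qed.

(** The Nash entropy at time t is the same at all points, so averaging it against a kernel of mass 1
    leaves it unchanged. *)
Lemma euclid_heat_nash (N : R) : is_mmd E N -> forall (x : E) (t s : R), 0 < t -> 0 < s ->
  heat_nash N x t s = nash N 1 ((0 : 'rV[R]_m) : E) + (m%:R - N) / 2 * ln t.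
Proof.
move=> hE x t s t0 s0.
have hp := heat_kernelP (mmd_heat_kernel hE).
rewrite /heat_nash /kernel_op.
set C := RHS.
transitivity (mmd_integral (fun y : E => heat_kernel s x y * C)).
  by apply: eq_Rintegral => y _; rewrite euclid_nash.
rewrite /mmd_integral RintegralZr//; last exact: (heat_kernel_integrable hp).
by rewrite -[X in X * _]/(mmd_integral _) (heat_kernel_mass_real hp)// mul1r.
Qed.

End euclid_similarity.

Unset Implicit Arguments.
Set Strict Implicit.
Set Printing Implicit Defensive.

Theorem theorem1p6 (R : realType) (X : mmd_data R) (sigma N q : R)
  (hN : 0 < N) (hq : 0 < q) (hqN : q <= N)
  (hX : is_mmd X N) (hcod : HSCod sigma N q X)
  (a_ c_ : nat -> {posnum R}) (x_ : nat -> X)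
  (ha : nonincreasing_seq (fun i => (a_ i)%:num))
  (ha0 : (a_ i)%:num @[i --> \oo] --> (0 : R))
  (Xoo : mmd_data R) (xoo : Xoo) (hXoo : is_mmd Xoo N)
  (hcvg : entropy_heat_cvg N (fun i => rescale (a_ i) (c_ i) X) x_ Xoo xoo) :
  forward_comparison N q Xoo /\
  forall (m : nat) (c : {posnum R}) (b_ c'_ : nat -> {posnum R})
    (y_ : nat -> Xoo),
    entropy_heat_cvg N (fun j => rescale (b_ j) (c'_ j) Xoo) y_
      (euclid m c) (0 : 'rV[R]_m) ->
    m%:R <= N - q.
Proof.
have hf : forward_comparison N q Xoo := HSCod_tangent hq hX hcod ha0 hcvg.
split=> // m c b_ c'_ y_ hc.
(* The convergence includes that its limit is an MMD space, which provides the heat kernel of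
   R^m. *)
have hE : is_mmd (euclid m c) N by case: hc => _ [].
have hfE := forward_comparison_tangent hXoo hf hc.
have := @forward_comparison_log R (euclid m c) (0 : 'rV[R]_m) N q _ _
  (euclid_heat_nash hE (0 : 'rV[R]_m)) hfE.
lra.
Qed.
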